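(* Let $Z\in\mathbb{R}^{p_1\times p_2}$ have independent mean-zero entries, and suppose there are $\sigma_1,\ldots,\sigma_{p_1}\ge 0$ and a constant $C_K>0$ such that $\|Z_{ij}/\sigma_i\|_{\psi_2}\le C_K$ for all $i,j$. Then there is a constant $C>0$ depending only on $C_K$ such that \[ \mathbb{E}\|ZZ^\top-\mathbb{E}ZZ^\top\|\le C\left(\sum_{i=1}^{p_1}\sigma_i^2+\sqrt{p_2\sum_{i=1}^{p_1}\sigma_i^2}\cdot\max_i\sigma_i\right). \]
   Context: $\|\cdot\|$ is the spectral norm. $\|X\|_{\psi_2}=\inf\{x>0:\mathbb{E}\exp((|X|/x)^2)\le 2\}$. *)

(* Defs.v *)
From HB Require Import structures.
From mathcomp Require Import all_boot all_order all_algebra.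
From mathcomp Require Import all_classical all_reals all_analysis.
Set Implicit Arguments. Unset Strict Implicit. Unset Printing Implicit Defensive.
Import Order.TTheory GRing.Theory Num.Theory.
Import numFieldNormedType.Exports.
Local Open Scope classical_set_scope.
Local Open Scope ring_scope.

(* Mutual independence of a finite family of real random variables:
   for every choice of Borel sets B i, P (/\_i {X i in B i}) = prod_i P {X i in B i}.
   (Taking B i = setT for indices outside a subfamily recovers the product rule
   for every finite subfamily.) *)
Definition mutually_independent {d} {T : measurableType d} {R : realType}
  (P : probability T R) (I : finType) (X : I -> T -> R) : Prop :=
  (forall i, measurable_fun setT (X i)) /\
  forall B : I -> set R, (forall i, measurable (B i)) ->
    fine (P (\big[setI/setT]_i (X i @^-1` B i))) =
    \prod_i fine (P (X i @^-1` B i)).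

Definition expect {d} {T : measurableType d} {R : realType}
  (P : probability T R) (X : T -> R) : R := Rintegral P setT X.

(* psi_2 (Orlicz) norm: inf { x > 0 : E exp((|X|/x)^2) <= 2 }, in \bar R
   (equal to +oo when the set is empty). *)
Definition psi2norm {d} {T : measurableType d} {R : realType}
  (P : probability T R) (X : T -> R) : \bar R :=
  ereal_inf [set x%:E | x in [set x : R | 0 < x /\
    (\int[P]_w (expR ((`|X w| / x) ^+ 2))%:E <= 2%:E)%E]].

Definition vnorm2 {R : realType} {n : nat} (v : 'cV[R]_n) : R :=
  Num.sqrt (\sum_i v i ord0 ^+ 2).

Definition specnorm {R : realType} {m n : nat} (A : 'M[R]_(m, n)) : R :=
  sup [set vnorm2 (A *m x) | x in [set x : 'cV[R]_n | vnorm2 x = 1]].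

(* Main.v *)
(* A PAC-Bayesian argument, dimension free because no net is used. Let m be the
   largest scale and N a multiple of the effective rank sum_i s_i^2 / m^2. A unit
   vector x is the mean of a random point theta whose i-th coordinate averages N
   independent signs of mean x_i. Such a theta satisfies
   sum_i s_i^2 theta_i^2 <= 256 m^2 with high probability, and the law of theta
   has chi-square divergence at most e^N from the uniform law on signs. Hence for
   M = Z Z^T - E Z Z^T and unit x, y the Gibbs variational principle bounds
   l x^T M y, up to a self-bounding error (9/16) l ||M||, by N plus a partition
   function which does not depend on x and y: the average of
   exp (2 l theta^T M eta) over pairs of admissible sign averages. Its
   expectation factorizes over the columns of Z, and each column contributes the
   moment generating function of a centered product of two sub-Gaussian
   variables. Optimizing l gives E ||M|| <= C m^2 (N + sqrt (N p2)). *)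
Require Import Defs.
From HB Require Import structures.
From mathcomp Require Import all_boot all_order all_algebra.
From mathcomp Require Import all_classical all_reals all_analysis.
From mathcomp Require Import measurable_realfun ring lra.
Import Order.TTheory GRing.Theory Num.Theory.
Import numFieldNormedType.Exports.
Local Open Scope classical_set_scope.
Local Open Scope ring_scope.
Set Implicit Arguments. Unset Strict Implicit. Unset Printing Implicit Defensive.

(** * Independence *)

(** The obstacle is that a product of two sub-Gaussian variables is only sub-exponential: the moment
    generating function of one column is under control only for l up to the order of 1 / sum_i s_i^2
    theta_i^2. Averaging N signs adds about (sum_i s_i^2) / N to that sum, which stays of order m^2
    once N dominates the effective rank; the rare larger theta still have to be discarded.
    Discarding them moves the mean away from x, by at most 1/4 in norm, whence 9/16 = 1/4 + 1/4 +
    1/16. Being below 1 and multiplying a finite norm, this error is absorbed. Chi-square is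
    preferred to relative entropy because the density of the sign law has the explicit second moment
    prod_i (1 + x_i^2)^N; AM-GM then replaces the entropy duality, at the price of 2 l in the
    exponent. The two terms of the final bound come from l of order m^-2 sqrt (N / (N + p2)), which
    balances N / l against p2 m^4 l without leaving the admissible range. *)

Lemma integral_mul_of_indep d d1 d2 (T : measurableType d) (T1 : measurableType d1)
    (T2 : measurableType d2) (R : realType) (P : probability T R)
    (u : {mfun T >-> T1}) (v : {mfun T >-> T2}) (g : T1 -> R) (h : T2 -> R) :
  (forall C D, measurable C -> measurable D ->
    P (u @^-1` C `&` v @^-1` D) = (P (u @^-1` C) * P (v @^-1` D))%E) ->
  measurable_fun setT g -> measurable_fun setT h ->
  (forall x, 0 <= g x) -> (forall y, 0 <= h y) ->
  (\int[P]_w (g (u w) * h (v w))%:E =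
   \int[P]_w (g (u w))%:E * \int[P]_w (h (v w))%:E)%E.
Proof.
move=> uv mg mh g0 h0.
pose phi (w : T) : T1 * T2 := (u w, v w).
have mphi : measurable_fun setT phi by exact: measurable_fun_pair.
pose iphi : {mfun T >-> (T1 * T2)%type} := HB.pack phi (isMeasurableFun.Build _ _ _ _ _ mphi).
pose f (z : T1 * T2) : \bar R := (g z.1 * h z.2)%:E.
have mf : measurable_fun [set: T1 * T2] f.
  apply/measurable_EFinP; apply: measurable_funM.
    exact: (measurableT_comp mg measurable_fst).
  exact: (measurableT_comp mh measurable_snd).
have f0 z : (0 <= f z)%E by rewrite lee_fin mulr_ge0.
have mgE : measurable_fun setT (fun x => (g x)%:E) by exact/measurable_EFinP.
have mhE : measurable_fun setT (fun x => (h x)%:E) by exact/measurable_EFinP.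
transitivity (\int[distribution P iphi]_z f z)%E.
  by rewrite ge0_integral_distribution.
(* The joint law agrees with the product of the marginals on rectangles, hence everywhere; Tonelli
   then separates the two factors. *)
transitivity (\int[(distribution P u \x distribution P v)%E]_z f z)%E.
  apply: eq_measure_integral => E mE _; apply/esym.
  by apply: product_measure_unique => // C D mC mD; exact: uv.
rewrite (fubini_tonelli1 f)//.
have -> : (\int[P]_w (g (u w))%:E = \int[distribution P u]_x (g x)%:E)%E.
  by rewrite (ge0_integral_distribution u mgE)// => x; rewrite lee_fin.
have -> : (\int[P]_w (h (v w))%:E = \int[distribution P v]_y (h y)%:E)%E.
  by rewrite (ge0_integral_distribution v mhE)// => x; rewrite lee_fin.
rewrite -ge0_integralZr//; last 2 first.
- by move=> x _; rewrite lee_fin.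
- by apply: integral_ge0 => x _; rewrite lee_fin.
apply: eq_integral => x _; rewrite -ge0_integralZl//; last by rewrite lee_fin.
by move=> y _; rewrite lee_fin.
Qed.

Section Independence.
Context {d : measure_display} {T : measurableType d} {R : realType}.
Context (P : probability T R) (I : finType) (X : I -> T -> R).

(** A pi-system generating the sigma-algebra of the coordinates in [A]. Intersections are taken
    rather than single events, so that it has the stability that uniqueness of measures asks for. *)
Definition cylinders (A : {set I}) : set (set T) :=
  [set E | exists2 B : I -> set R, (forall i, measurable (B i)) &
    E = \big[setI/setT]_(i in A) (X i @^-1` B i)].

Definition cylinder_measurable (A : {set I}) (g : T -> R) : Prop :=
  measurable_fun setT (g : g_sigma_algebraType (cylinders A) -> R).

Lemma cylinders_setI A : setI_closed (cylinders A).
Proof.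
move=> _ _ [B mB ->] [C mC ->]; exists (fun i => B i `&` C i).
  by move=> i; apply: measurableI.
rewrite -big_split; apply: eq_bigr => i _ /=.
by rewrite preimage_setI.
Qed.

Lemma cylinders_setT A : cylinders A setT.
Proof.
exists (fun=> setT) => //; rewrite big1// => i _.
Qed.

Lemma cylinders_sub (A B : {set I}) : A \subset B -> cylinders A `<=` cylinders B.
Proof.
move=> AB _ [C mC ->]; exists (fun i => if i \in A then C i else setT).
  by move=> i; case: ifP.
rewrite [RHS](big_setID A)/= (finset.setIidPr AB) [X in _ `&` X]big1 ?setIT.
  by apply: eq_bigr => i ->.
by move=> i; rewrite inE => /andP[/negbTE -> _].
Qed.

Lemma cylinder_measurable_sub (A B : {set I}) g :
  A \subset B -> cylinder_measurable A g -> cylinder_measurable B g.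
Proof.
move=> AB mg _ Y mY; have := mg measurableT Y mY.
apply: sub_smallest2r; first exact: smallest_sigma_algebra.
exact/cylinders_sub.
Qed.

Lemma cylinder_measurable_coord (A : {set I}) i :
  i \in A -> cylinder_measurable A (X i).
Proof.
move=> iA _ Y mY; rewrite setTI; apply: sub_sigma_algebra.
exists (fun k => if k == i then Y else setT); first by move=> k; case: ifP.
rewrite (bigD1 i)//= eqxx big1 ?setIT// => k /andP[_ /negbTE ->].
by rewrite preimage_setT.
Qed.

Hypothesis indep : mutually_independent P X.

Lemma cylinders_measurable A : cylinders A `<=` measurable.
Proof.
move=> _ [B mB ->]; apply: bigsetI_measurable => i _.
by rewrite -[_ @^-1` _]setTI; apply: indep.1.
Qed.

Lemma sigma_cylinders_measurable A : <<s cylinders A >> `<=` @measurable _ T.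
Proof.
apply: smallest_sub; last exact: cylinders_measurable.
exact: sigma_algebra_measurable.
Qed.

Lemma cylinders_prob (A : {set I}) (B : I -> set R) : (forall i, measurable (B i)) ->
  P (\big[setI/setT]_(i in A) (X i @^-1` B i)) =
  (\prod_(i in A) fine (P (X i @^-1` B i)))%:E.
Proof.
move=> mB; set E := (X in P X).
have -> : E = \big[setI/setT]_i (X i @^-1` (if i \in A then B i else setT)).
  rewrite /E big_mkcond; apply: eq_bigr => i _.
  by case: ifP => //; rewrite preimage_setT.
rewrite -[LHS]fineK ?fin_num_measure//; last first.
  apply: bigsetI_measurable => i _; rewrite -[_ @^-1` _]setTI.
  by apply: indep.1 => //; case: ifP.
rewrite indep.2; last by move=> i; case: ifP.
congr EFin; rewrite [RHS]big_mkcond; apply: eq_bigr => i _.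
by case: ifP => // _; rewrite preimage_setT probability_setT.
Qed.

Lemma cylinders_indep (A B : {set I}) (E F : set T) : A \subset ~: B ->
  cylinders A E -> cylinders B F -> P (E `&` F) = (P E * P F)%E.
Proof.
move=> AB [C mC ->] [D mD ->].
rewrite -finset.disjoints_subset in AB.
pose CD i := if i \in A then C i else D i.
have mCD i : measurable (CD i) by rewrite /CD; case: ifP.
have in_AB : A :|: B =i [predU A & B] by move=> i; rewrite !inE.
transitivity (P (\big[setI/setT]_(i in A :|: B) (X i @^-1` CD i))).
  congr (P _); rewrite (eq_bigl _ _ in_AB) bigU//=; congr (_ `&` _); apply: eq_bigr => i.
    by rewrite /CD => ->.
  by move=> iB; rewrite /CD (disjointFl AB iB).
rewrite !cylinders_prob// -EFinM; congr EFin.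
rewrite (eq_bigl _ _ in_AB) bigU//=; congr (_ * _); apply: eq_bigr => i.
  by rewrite /CD => ->.
by move=> iB; rewrite /CD (disjointFl AB iB).
Qed.

(** Pi-lambda argument: for fixed [F], both sides are finite measures in [E] (a restriction and a
    multiple of [P]) that agree on a generating pi-system. It is applied twice below, once to each
    event. *)
Let extend_indep (A : {set I}) F : measurable F ->
  (forall E, cylinders A E -> P (E `&` F) = (P E * P F)%E) ->
  forall E, <<s cylinders A >> E -> P (E `&` F) = (P E * P F)%E.
Proof.
move=> mF h E sE.
have PF0 : (0 <= fine (P F))%R by rewrite fine_ge0.
pose c : {nonneg R} := NngNum PF0.
have cE : (c%:num%:E = P F)%E by rewrite /= fineK// fin_num_measure.
have -> : P (E `&` F) = mrestr P mF E by [].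
have -> : (P E * P F)%E = mscale c P E by rewrite /mscale/= fineK ?fin_num_measure// muleC.
apply: (g_sigma_algebra_measure_unique (cylinders A) _ (fun=> setT)) => //.
- exact: cylinders_measurable.
- by move=> _; exact: cylinders_setT.
- by rewrite bigcup_const.
- exact: cylinders_setI.
- move=> C AC; transitivity (P (C `&` F)) => //; rewrite h//.
  by rewrite muleC -cE.
- move=> _; apply: (@le_lt_trans _ _ (P F)).
    by rewrite -[X in (_ <= P X)%E]setTI.
  by rewrite -cE ltry.
Qed.

Lemma sigma_cylinders_indep (A B : {set I}) E F : A \subset ~: B ->
  <<s cylinders A >> E -> <<s cylinders B >> F -> P (E `&` F) = (P E * P F)%E.
Proof.
move=> AB sE sF; apply: extend_indep sE; first exact: sigma_cylinders_measurable sF.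
move=> {}E cE; rewrite setIC muleC; apply: extend_indep sF.
  exact: cylinders_measurable cE.
by move=> {}F cF; rewrite setIC muleC; exact: cylinders_indep AB cE cF.
Qed.

Lemma integral_indepM (A B : {set I}) (g h : T -> R) : A \subset ~: B ->
  cylinder_measurable A g -> cylinder_measurable B h ->
  (forall w, 0 <= g w) -> (forall w, 0 <= h w) ->
  (\int[P]_w (g w * h w)%:E = \int[P]_w (g w)%:E * \int[P]_w (h w)%:E)%E.
Proof.
move=> AB mg mh g0 h0.
(* The random variables fed to [integral_mul_of_indep] are two copies of the identity of [T], whose
   targets carry the two coordinate sigma-algebras. *)
have mid (C : {set I}) : measurable_fun setT (id : T -> g_sigma_algebraType (cylinders C)).
  by move=> _ Y mY; rewrite setTI; exact: sigma_cylinders_measurable mY.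
pose i (C : {set I}) : {mfun T >-> g_sigma_algebraType (cylinders C)} :=
  HB.pack (id : T -> g_sigma_algebraType (cylinders C)) (isMeasurableFun.Build _ _ _ _ _ (mid C)).
apply: (integral_mul_of_indep (u := i A) (v := i B)) => // C D mC mD.
exact: (sigma_cylinders_indep AB mC mD).
Qed.

(** The map [c] cuts the coordinates into disjoint blocks: [id] makes each coordinate a block, [snd]
    groups matrix entries by column. Induction peels off one block; the remaining product depends on
    the union of the others. *)
Lemma integral_indep_prod (K : finType) (c : I -> K) (g : K -> T -> R) (Q : pred K) :
  (forall k, Q k -> cylinder_measurable [set i | c i == k]%SET (g k)) ->
  (forall k w, Q k -> 0 <= g k w) ->
  (\int[P]_w (\prod_(k | Q k) g k w)%:E = \prod_(k | Q k) \int[P]_w (g k w)%:E)%E.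
Proof.
move=> mg g0.
have [r [ur rQ rE]] : exists r : seq K, [/\ uniq r, {in r, forall k, Q k} &
    forall (S : Type) (idx : S) op (F : K -> S),
      \big[op/idx]_(k | Q k) F k = \big[op/idx]_(k <- r) F k].
  exists (seq.filter Q (index_enum K)); split; first by rewrite filter_uniq// index_enum_uniq.
    by move=> k; rewrite mem_filter => /andP[].
  by move=> *; rewrite big_filter.
under eq_integral do rewrite rE.
rewrite rE {rE}.
elim: r ur rQ => [_ _|k r IH /= /andP[kr ur] rQ].
  under eq_integral do rewrite big_nil.
  by rewrite big_nil integral_cst// mul1e; exact: probability_setT.
under eq_integral do rewrite big_cons.
have rQ' : {in r, forall k, Q k} by move=> l lr; apply: rQ; rewrite inE lr orbT.
have Qk : Q k by apply: rQ; rewrite mem_head.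
rewrite big_cons -IH//.
apply: (@integral_indepM [set i | c i == k]%SET [set i | c i \in r]%SET).
- by apply/fintype.subsetP => i; rewrite !inE => /eqP ->.
- exact: mg.
- elim: r rQ' {IH ur kr rQ} => [_|l r IH rQ].
    have -> : (fun w => \prod_(j <- [::]) g j w) = cst 1.
      by apply/funext => w; rewrite big_nil.
    exact: measurable_cst.
  have rQ' : {in r, forall k, Q k} by move=> m mr; apply: rQ; rewrite inE mr orbT.
  have -> : (fun w => \prod_(j <- l :: r) g j w) =
      (fun w => g l w * \prod_(j <- r) g j w).
    by apply/funext => w; rewrite big_cons.
  apply: measurable_funM.
    apply: cylinder_measurable_sub (mg l _); last by apply: rQ; rewrite mem_head.
    by apply/fintype.subsetP => i; rewrite !inE => ->.
  apply: cylinder_measurable_sub (IH rQ').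
  by apply/fintype.subsetP => i; rewrite !inE => ->; rewrite orbT.
- by move=> w; exact: g0.
- by move=> w; rewrite big_seq prodr_ge0// => l lr; apply: g0; exact: rQ'.
Qed.

End Independence.

(** * Sub-Gaussian variables *)

Section ScalarBounds.
Context {R : realType}.
Implicit Types x v r : R.

Lemma expR_mul1B_le1 x : expR x * (1 - x) <= 1.
Proof.
have := expR_ge1Dx (- x); rewrite expRN => h.
have e0 := expR_gt0 x.
by rewrite -[leRHS](mulfV (lt0r_neq0 e0)) ler_pM2l.
Qed.

(** Meant to be integrated for centered [x], where the linear term drops out and only an exponential
    of a square remains. The factor 2 makes the middle range elementary, through
    [expR x <= 1 / (1 - x)]. *)
Lemma expR_le_id_expR_sqr x : expR x <= x + expR (2 * x ^+ 2).
Proof.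
have h1 := expR_ge1Dx (2 * x ^+ 2).
have h2 := expR_mul1B_le1 x.
have [xl|xl] := leP (2^-1) x.
  apply: (@le_trans _ _ (expR (2 * x ^+ 2))); last by lra.
  by rewrite ler_expR; nra.
have [xl'|xl'] := leP x (- 2^-1).
  apply: (@le_trans _ _ 1); last by nra.
  by rewrite expR_le1; lra.
apply: (@le_trans _ _ (x + (1 + 2 * x ^+ 2))); last by lra.
have x1 : 0 < 1 - x by lra.
rewrite -(ler_pM2r x1); apply: (le_trans h2).
have -> : (x + (1 + 2 * x ^+ 2)) * (1 - x) = 1 + x ^+ 2 * (1 - 2 * x) by ring.
by rewrite lerDl mulr_ge0 ?sqr_ge0//; lra.
Qed.

Lemma expR_le_taylor2 v : expR v <= 1 + v + v ^+ 2 * expR `|v|.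
Proof.
have h2 := expR_mul1B_le1 v.
have [v0|v0] := leP 0 v.
  rewrite ger0_norm//; have e0 := expR_gt0 v.
  have h3 : expR v - 1 <= v * expR v by lra.
  have h4 : v * (expR v - 1) <= v * (v * expR v) by rewrite ler_wpM2l.
  by rewrite expr2 -mulrA; lra.
have e1 : 1 <= expR `|v| by rewrite -expR0 ler_expR.
apply: (@le_trans _ _ (1 + v + v ^+ 2)).
  have x1 : 0 < 1 - v by lra.
  rewrite -(ler_pM2r x1); apply: (le_trans h2).
  have -> : (1 + v + v ^+ 2) * (1 - v) = 1 + v ^+ 2 * (- v) by ring.
  by rewrite lerDl mulr_ge0 ?sqr_ge0//; lra.
by rewrite lerD2l ler_peMr// sqr_ge0.
Qed.

(** Convexity between 0 and [v]. It shrinks an exponent: a mean of [expR v] at most 2 gives a mean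
    of [expR (r * v)] at most [1 + r]. *)
Lemma expR_convex1 r v : 0 <= r <= 1 -> expR (r * v) <= 1 - r + r * expR v.
Proof.
move=> /andP[r0 r1].
have e0 := expR_gt0 (r * v).
have h1 := expR_ge1Dx ((1 - r) * v).
have h2 := expR_ge1Dx (- (r * v)).
have -> : 1 - r + r * expR v = expR (r * v) * ((1 - r) * expR (- (r * v)) + r * expR ((1 - r) * v)).
  have E2 : expR (r * v) * expR ((1 - r) * v) = expR v by rewrite -expRD; congr expR; ring.
  by rewrite [RHS]mulrDr ![expR (r * v) * (_ * _)]mulrCA expRxMexpNx_1 E2 mulr1.
rewrite -{1}[expR (r * v)]mulr1 ler_pM2l//.
have h3 : r * (1 + (1 - r) * v) <= r * expR ((1 - r) * v) by rewrite ler_wpM2l.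
have h4 : (1 - r) * (1 + - (r * v)) <= (1 - r) * expR (- (r * v)) by rewrite ler_wpM2l//; lra.
lra.
Qed.

Lemma expR1_le4 : expR 1 <= 4 :> R.
Proof.
have h := expR_mul1B_le1 (2^-1).
have e0 := expR_gt0 (2^-1 : R).
have -> : 1 = 2^-1 + 2^-1 :> R by lra.
rewrite expRD; nra.
Qed.

End ScalarBounds.

Section IntegralBounds.
Context {d : measure_display} {T : measurableType d} {R : realType}.
Context (P : probability T R).
Implicit Types f g X Y a b : T -> R.

Lemma integral_cst_prob (x : R) : (\int[P]_w x%:E = x%:E)%E.
Proof.
transitivity (x%:E * P setT)%E; first exact: integral_cst.
by rewrite probability_setT mule1.
Qed.

Lemma integral_affine_le f (x y c : R) : measurable_fun setT f ->
  (forall w, 0 <= f w) -> 0 <= x -> 0 <= y ->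
  (\int[P]_w (f w)%:E <= c%:E)%E -> (\int[P]_w (x + y * f w)%:E <= (x + y * c)%:E)%E.
Proof.
move=> mf f0 x0 y0 fc.
under eq_integral do rewrite EFinD EFinM.
rewrite ge0_integralD//; last 2 first.
- by move=> w _; rewrite -EFinM lee_fin mulr_ge0.
- by under eq_fun do rewrite -EFinM; exact/measurable_EFinP/measurable_funM.
rewrite ge0_integralZl_EFin//; last 2 first.
- by move=> w _; rewrite lee_fin.
- exact/measurable_EFinP.
rewrite integral_cst_prob EFinD leeD2l// EFinM.
by rewrite lee_wpmul2l.
Qed.

(** The device by which centering enters each moment generating function: the first-order term [X]
    of a pointwise bound integrates to zero. Integrability of [g] is automatic unless the right side
    is infinite. *)
Lemma le_integral_centered X f g :
  P.-integrable setT (EFin \o X) -> expect P X = 0 ->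
  measurable_fun setT f -> measurable_fun setT g ->
  (forall w, 0 <= f w) -> (forall w, 0 <= g w) ->
  (forall w, f w <= X w + g w) ->
  (\int[P]_w (f w)%:E <= \int[P]_w (g w)%:E)%E.
Proof.
move=> iX EX mf mg f0 g0 fg.
have [->|goo] := eqVneq (\int[P]_w (g w)%:E)%E +oo%E; first by rewrite leey.
have ig : P.-integrable setT (EFin \o g).
  apply/integrableP; split; first exact/measurable_EFinP.
  under eq_integral do rewrite /= ger0_norm//.
  by rewrite ltey.
have X0 : (\int[P]_w (X w)%:E = 0)%E.
  by rewrite -[LHS]fineK ?integrable_fin_num//; congr EFin.
apply: (@le_trans _ _ (\int[P]_w (X w + g w)%:E)%E).
  apply: ge0_le_integral => //.
  - by move=> w _; rewrite lee_fin.
  - exact/measurable_EFinP.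
  - apply/measurable_EFinP/measurable_funD => //.
    by apply/measurable_EFinP; exact: measurable_int iX.
  - by move=> w _; rewrite lee_fin.
under eq_integral do rewrite EFinD.
by rewrite integralD// X0 add0e.
Qed.

(** Two regimes in [q], the square of [t * s]. For small [q] centering kills the first-order term
    and convexity gives [1 + 2 * q]; for large [q] a constant prefactor is harmless. *)
Lemma mgf_le_of_exp_sqr Y (s t : R) : 0 < s ->
  P.-integrable setT (EFin \o Y) -> expect P Y = 0 ->
  (\int[P]_w (expR ((Y w / s) ^+ 2))%:E <= 2%:E)%E ->
  (\int[P]_w (expR (t * Y w))%:E <= (expR (2 * (t ^+ 2 * s ^+ 2)))%:E)%E.
Proof.
move=> s0 iY EY Ys.
have mY : measurable_fun setT Y by apply/measurable_EFinP; exact: measurable_int iY.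
set G := fun w => expR ((Y w / s) ^+ 2).
have mG : measurable_fun setT G.
  apply: measurableT_comp => //; apply: measurable_funX.
  by apply: measurable_funM.
have G0 w : 0 <= G w by exact: expR_ge0.
have tY w : t ^+ 2 * Y w ^+ 2 = t ^+ 2 * s ^+ 2 * (Y w / s) ^+ 2.
  by field; rewrite gt_eqF.
set q := t ^+ 2 * s ^+ 2 in tY *.
have qE : q = t ^+ 2 * s ^+ 2 by []; clearbody q.
have q0 : 0 <= q by rewrite qE mulr_ge0 ?sqr_ge0.
have metY : measurable_fun setT (fun w => expR (t * Y w)).
  by apply: measurableT_comp => //; apply: measurable_funM.
have [q1|q1] := leP (2 * q) 1.
  apply: (@le_trans _ _ (\int[P]_w ((1 - 2 * q) + 2 * q * G w)%:E)%E).
    apply: (@le_integral_centered (fun w => t * Y w)) => //.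
    - by rewrite (_ : _ \o _ = (fun w => t%:E * (Y w)%:E)%E)//; exact: integrableZl.
    - by rewrite /expect RintegralZl// -/(expect P Y) EY mulr0.
    - by apply: measurable_funD => //; apply: measurable_funM.
    - by move=> w; rewrite addr_ge0 ?mulr_ge0//; lra.
    - move=> w; apply: (le_trans (expR_le_id_expR_sqr _)); rewrite lerD2l.
      by rewrite exprMn tY mulrA expR_convex1//; lra.
  apply: (le_trans (integral_affine_le (c := 2) _ _ _ _ _)) => //; [lra|lra|].
  rewrite lee_fin; apply: le_trans (expR_ge1Dx _); lra.
(* AM-GM gives [t * Y w <= q + (Y w / s) ^+ 2 / 4], so the integral is at most [5 / 4 * expR q]; and
   [expR q >= 1 + q > 5 / 4] since [q > 1 / 2]. *)
apply: (@le_trans _ _ (\int[P]_w (expR q * (1 - 4^-1) + expR q * 4^-1 * G w)%:E)%E).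
  apply: ge0_le_integral => //.
  - exact/measurable_EFinP.
  - by apply/measurable_EFinP/measurable_funD => //; apply: measurable_funM.
  - move=> w _; rewrite lee_fin -mulrA -mulrDr.
    apply: (@le_trans _ _ (expR (q + 4^-1 * (Y w / s) ^+ 2))).
      rewrite ler_expR.
      have : 0 <= (t * s - 2^-1 * (Y w / s)) ^+ 2 by exact: sqr_ge0.
      have -> : (t * s - 2^-1 * (Y w / s)) ^+ 2 = q + 4^-1 * (Y w / s) ^+ 2 - t * Y w.
        by rewrite qE; field; rewrite gt_eqF.
      lra.
    rewrite expRD ler_pM2l ?expR_gt0// expR_convex1//; lra.
have e0 := expR_gt0 q.
have x0 : 0 <= expR q * (1 - 4^-1) by lra.
have y0 : 0 <= expR q * 4^-1 by lra.
apply: (le_trans (integral_affine_le mG G0 x0 y0 Ys)).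
have -> : expR (2 * q) = expR q * expR q by rewrite -expRD; congr expR; ring.
rewrite lee_fin; have := expR_ge1Dx q; nra.
Qed.

End IntegralBounds.

Lemma ffact_le_expn n m : (n ^_ m <= n ^ m)%N.
Proof.
elim: m => [|m IH]; first by rewrite ffactn0 expn0.
by rewrite ffactnSr expnSr leq_mul// leq_subr.
Qed.

Lemma fact_double_le k : ((2 * k)`! <= (2 * k) ^ k * k`!)%N.
Proof.
have h : (k <= 2 * k)%N by rewrite leq_pmull.
have := ffact_fact h; rewrite mul2n -addnn addnK => <-.
by rewrite leq_mul2r ffact_le_expn orbT.
Qed.

Section MoreScalar.
Context {R : realType}.

Lemma pow_le_fact_expR n (x : R) : 0 <= x -> x ^+ n <= n`!%:R * expR x.
Proof.
move=> x0; case: n => [|n].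
  by rewrite expr0 fact0 mul1r -expR0 ler_expR.
have := expR_ge1Dxn n x0 => h.
have f0 : 0 < (n.+1)`!%:R :> R by rewrite ltr0n fact_gt0.
rewrite mulrC -ler_pdivrMr//; lra.
Qed.

Lemma expR_norm_le (x : R) : expR `|x| <= expR x + expR (- x).
Proof. by case: (ger0P x) => _; rewrite ?lerDl ?lerDr expR_ge0. Qed.

Lemma expR_nneseries (x : R) :
  ((expR x)%:E = \sum_(0 <= n <oo) (x ^+ n / n`!%:R)%:E)%E.
Proof.
rewrite /expR -EFin_lim; last exact: is_cvg_series_exp_coeff.
rewrite (_ : EFin \o _ = (fun n => \sum_(0 <= i < n) (x ^+ i / i`!%:R)%:E)%E)//.
by apply/funext => n /=; rewrite /series /= sumEFin.
Qed.

End MoreScalar.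

Section SubGaussian.
Context {d : measure_display} {T : measurableType d} {R : realType}.
Context (P : probability T R).
Implicit Types a b : T -> R.

(** Bounds one term of the exponential series of [a w ^+ 2 / (48 * V)]. The even power is compared
    with [(2 * k)]! * expR |t a|[, and]fact_double_le[turns that factorial into the]k[!] of the
    series. *)
Lemma moment_le_of_mgf a (V : R) (k : nat) : 0 < V -> (0 < k)%N ->
  measurable_fun setT a ->
  (forall t : R, \int[P]_w (expR (t * a w))%:E <= (expR (2 * (t ^+ 2 * V)))%:E)%E ->
  (\int[P]_w ((a w ^+ 2 / (48 * V)) ^+ k / k`!%:R)%:E <= (2 * 3^-1 ^+ k)%:E)%E.
Proof.
move=> V0 k0 ma mgf.
have k0' : 0 < k%:R :> R by rewrite ltr0n.
(* This [t] minimises [expR (2 * t ^+ 2 * V) / t ^+ (2 * k)]; the exponential becomes [expR k], at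
   most [4 ^+ k]. *)
pose t : R := Num.sqrt (k%:R / (2 * V)).
have t2 : t ^+ 2 = k%:R / (2 * V) by rewrite sqr_sqrtr// divr_ge0// ?mulr_ge0// ltW.
have f0 : 0 < k`!%:R :> R by rewrite ltr0n fact_gt0.
have mexp (u : R) : measurable_fun setT (fun w => expR (u * a w)).
  by apply: measurableT_comp => //; apply: measurable_funM.
apply: (@le_trans _ _ (\int[P]_w (12^-1 ^+ k * (expR (t * a w) + expR (- t * a w)))%:E)%E).
  apply: ge0_le_integral => //.
  - move=> w _; rewrite lee_fin mulr_ge0 ?invr_ge0 ?exprn_ge0 ?divr_ge0 ?sqr_ge0//.
    by rewrite mulr_ge0// ltW.
  - apply/measurable_EFinP; apply: measurable_funM => //; apply: measurable_funX.
    by apply: measurable_funM => //; exact: measurable_funX.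
  - by apply/measurable_EFinP; apply: measurable_funM => //; exact: measurable_funD.
  - move=> w _; rewrite lee_fin mulNr.
    have -> : a w ^+ 2 / (48 * V) = (24 * k%:R)^-1 * `|t * a w| ^+ 2.
      by rewrite real_normK ?num_real// exprMn t2; field; rewrite !gt_eqF.
    rewrite exprMn -exprM.
    have h1 := pow_le_fact_expR (2 * k) (normr_ge0 (t * a w)).
    have h2 := expR_norm_le (t * a w).
    have h3 : (2 * k)`!%:R <= (2 * k%:R) ^+ k * k`!%:R :> R.
      by rewrite -natrM -natrX -natrM ler_nat fact_double_le.
    have h4 : `|t * a w| ^+ (2 * k) <=
        (2 * k%:R) ^+ k * k`!%:R * (expR (t * a w) + expR (- (t * a w))).
      by apply: (le_trans h1); rewrite ler_pM// expR_ge0.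
    have c0 : 0 <= (24 * k%:R)^-1 ^+ k / k`!%:R :> R.
      by rewrite divr_ge0// exprn_ge0// invr_ge0 mulr_ge0.
    have := ler_wpM2l c0 h4.
    rewrite [X in X <= _ -> _](_ : _ =
      (24 * k%:R)^-1 ^+ k * `|t * a w| ^+ (2 * k) / k`!%:R); last by ring.
    move=> h5; apply: (le_trans h5); rewrite mulrA ler_wpM2r ?addr_ge0 ?expR_ge0//.
    have -> : (24 * k%:R)^-1 ^+ k / k`!%:R * ((2 * k%:R) ^+ k * k`!%:R) =
        ((24 * k%:R)^-1 * (2 * k%:R)) ^+ k :> R.
      by rewrite mulrACA mulVf ?gt_eqF// mulr1 -exprMn.
    rewrite (_ : (24 * k%:R)^-1 * (2 * k%:R) = 12^-1 :> R)//; field.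
    by rewrite gt_eqF.
have mE (u : R) : measurable_fun setT (fun w => (expR (u * a w))%:E).
  exact/measurable_EFinP.
under eq_integral do rewrite EFinM EFinD.
rewrite ge0_integralZl_EFin//; last 2 first.
- by move=> w _; rewrite adde_ge0.
- exact: emeasurable_funD.
rewrite ge0_integralD//.
have e1 : 2 * (t ^+ 2 * V) = k%:R by rewrite t2; field; rewrite gt_eqF.
have I1 := mgf t; have I2 := mgf (- t); rewrite sqrrN e1 in I2; rewrite e1 in I1.
apply: (@le_trans _ _ ((12^-1 ^+ k)%:E * ((expR k%:R)%:E + (expR k%:R)%:E))%E).
  by rewrite lee_wpmul2l ?lee_fin ?exprn_ge0// leeD.
rewrite -EFinD -EFinM lee_fin.
have e4 : expR k%:R <= 4 ^+ k :> R.
  by rewrite -[k%:R]mulr1 expRM_natl lerXn2r ?nnegrE ?expR_ge0// expR1_le4.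
have -> : 3^-1 ^+ k = 12^-1 ^+ k * 4 ^+ k :> R by rewrite -exprMn; congr (_ ^+ _); field.
have c0 : 0 <= 12^-1 ^+ k :> R by rewrite exprn_ge0.
nra.
Qed.

(** Converse of [mgf_le_of_exp_sqr], summing the exponential series term by term. The constant 48
    makes the ratio one third, so that the total is 1 + 2 (1/3 + 1/9 + ...) = 2. *)
Lemma exp_sqr_le_of_mgf a (V : R) : 0 < V ->
  measurable_fun setT a ->
  (forall t : R, \int[P]_w (expR (t * a w))%:E <= (expR (2 * (t ^+ 2 * V)))%:E)%E ->
  (\int[P]_w (expR ((48 * V)^-1 * a w ^+ 2))%:E <= 2%:E)%E.
Proof.
move=> V0 ma mgf.
pose f n w : \bar R := ((a w ^+ 2 / (48 * V)) ^+ n / n`!%:R)%:E.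
have f0 n w : (0 <= f n w)%E.
  by rewrite lee_fin mulr_ge0 ?invr_ge0 ?exprn_ge0 ?divr_ge0 ?sqr_ge0// mulr_ge0// ltW.
have mf n : measurable_fun setT (f n).
  apply/measurable_EFinP; apply: measurable_funM => //; apply: measurable_funX.
  by apply: measurable_funM => //; exact: measurable_funX.
have -> : (\int[P]_w (expR ((48 * V)^-1 * a w ^+ 2))%:E = \int[P]_w (\sum_(0 <= n <oo) f n w))%E.
  by apply: eq_integral => w _; rewrite mulrC expR_nneseries.
rewrite integral_nneseries//.
apply: lime_le; first by apply: is_cvg_nneseries => n _ _; exact: integral_ge0.
apply: nearW => -[|n]; first by rewrite big_geq.
apply: (@le_trans _ _ ((2 - 3^-1 ^+ n)%:E)); last first.
  by rewrite lee_fin gerBl exprn_ge0.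
elim: n => [|n IH].
  rewrite big_nat1 /f; under eq_integral do rewrite expr0 fact0 divr1.
  rewrite integral_cst_prob lee_fin expr0; lra.
rewrite big_nat_recr//=; apply: (le_trans (leeD IH (moment_le_of_mgf V0 (ltn0Sn n) ma mgf))).
rewrite -EFinD lee_fin exprS; lra.
Qed.

Lemma integrable_sqr_of_exp_sqr a (k : R) : 0 < k -> measurable_fun setT a ->
  (\int[P]_w (expR (k * a w ^+ 2))%:E <= 2%:E)%E ->
  P.-integrable setT (EFin \o (fun w => a w ^+ 2)).
Proof.
move=> k0 ma ha; apply/integrableP; split.
  by apply/measurable_EFinP; exact: measurable_funX.
apply: (@le_lt_trans _ _ (\int[P]_w (0 + k^-1 * expR (k * a w ^+ 2))%:E)%E).
  apply: ge0_le_integral => //.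
  - by apply/measurable_EFinP/measurableT_comp => //; exact: measurable_funX.
  - apply/measurable_EFinP; apply: measurable_funD => //; apply: measurable_funM => //.
    by apply: measurableT_comp => //; apply: measurable_funM => //; exact: measurable_funX.
  - move=> w _; rewrite lee_fin add0r /= ger0_norm ?sqr_ge0// -[leLHS](mulKf (lt0r_neq0 k0)).
    rewrite ler_wpM2l ?invr_ge0 ?(ltW k0)//; have := expR_ge1Dx (k * a w ^+ 2); lra.
have k0' : 0 <= k^-1 by rewrite invr_ge0 ltW.
apply: (@le_lt_trans _ _ ((0 + k^-1 * 2)%:E)); last by rewrite ltry.
apply: (integral_affine_le (c := 2)) => //.
by apply: measurableT_comp => //; apply: measurable_funM => //; exact: measurable_funX.
Qed.

Lemma integrable_mul_of_sqr a b : measurable_fun setT a -> measurable_fun setT b ->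
  P.-integrable setT (EFin \o (fun w => a w ^+ 2)) ->
  P.-integrable setT (EFin \o (fun w => b w ^+ 2)) ->
  P.-integrable setT (EFin \o (fun w => a w * b w)).
Proof.
move=> ma mb ia ib.
apply: (@le_integrable _ _ _ P setT measurableT _ (EFin \o (fun w => a w ^+ 2 + b w ^+ 2))).
- by apply/measurable_EFinP; exact: measurable_funM.
- move=> w _ /=; rewrite lee_fin [leRHS]ger0_norm ?addr_ge0 ?sqr_ge0//.
  rewrite ler_norml; have := sqr_ge0 (a w + b w); have := sqr_ge0 (a w - b w).
  move=> h1 h2; apply/andP; split; nra.
- rewrite (_ : _ \o _ = (EFin \o (fun w => (a w ^+ 2)%R)) \+ (EFin \o (fun w => (b w ^+ 2)%R)))%E//.
  exact: integrableD.
Qed.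

(** No independence of [a] and [b] is assumed: AM-GM bounds the product by the two squares. A
    second-order Taylor bound leaves a remainder that is integrable because [|u| <= k / 2]. *)
Lemma mgf_centered_mul a b (k u : R) : 0 < k ->
  measurable_fun setT a -> measurable_fun setT b ->
  (\int[P]_w (expR (k * a w ^+ 2))%:E <= 2%:E)%E ->
  (\int[P]_w (expR (k * b w ^+ 2))%:E <= 2%:E)%E ->
  `|u| <= k / 2 ->
  (\int[P]_w (expR (u * (a w * b w - expect P (fun w => a w * b w))%R))%:E <=
    (expR (256 * (u ^+ 2 / k ^+ 2)))%:E)%E.
Proof.
move=> k0 ma mb ha hb uk.
set c := expect P _.
pose G w := expR (k * a w ^+ 2) + expR (k * b w ^+ 2).
have mG : measurable_fun setT G.
  by apply: measurable_funD => //; apply: measurableT_comp => //;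
    apply: measurable_funM => //; exact: measurable_funX.
have G0 w : 0 <= G w by rewrite addr_ge0 ?expR_ge0.
have IG : (\int[P]_w (G w)%:E <= 4%:E)%E.
  under eq_integral do rewrite EFinD.
  rewrite ge0_integralD//; last 2 first.
  - by apply/measurable_EFinP; apply: measurableT_comp => //;
      apply: measurable_funM => //; exact: measurable_funX.
  - by apply/measurable_EFinP; apply: measurableT_comp => //;
      apply: measurable_funM => //; exact: measurable_funX.
  by rewrite (_ : 4%:E = 2%:E + 2%:E)%E ?leeD// -EFinD; congr EFin; lra.
have iab : P.-integrable setT (EFin \o (fun w => a w * b w)).
  by apply: integrable_mul_of_sqr => //; exact: integrable_sqr_of_exp_sqr k0 _ _.
have abG w : k * `|a w * b w| <= 2^-1 * (k * a w ^+ 2 + k * b w ^+ 2).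
  have : `|a w * b w| <= 2^-1 * (a w ^+ 2 + b w ^+ 2).
    rewrite ler_norml; have := sqr_ge0 (a w + b w); have := sqr_ge0 (a w - b w).
    move=> h1 h2; apply/andP; split; nra.
  by move=> /(ler_wpM2l (ltW k0)); rewrite -mulrDr mulrCA.
have kc : k * `|c| <= 2.
  have h : (`|c|%:E <= (0 + (2 * k)^-1 * 4)%:E)%E.
    apply: (@le_trans _ _ (\int[P]_w (`|a w * b w|)%:E)%E).
      have ->: (\int[P]_w (`|a w * b w|)%:E = (expect P (fun w => `|a w * b w|))%:E)%E.
        rewrite /expect /Rintegral fineK// integrable_fin_num//.
        exact: (integrable_norm iab).
      by rewrite lee_fin le_normr_Rintegral.
    apply: (@le_trans _ _ (\int[P]_w (0 + (2 * k)^-1 * G w)%:E)%E).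
      apply: ge0_le_integral => //.
      - by apply/measurable_EFinP; apply: measurableT_comp => //; exact: measurable_funM.
      - by apply/measurable_EFinP; apply: measurable_funD => //; apply: measurable_funM.
      - move=> w _; rewrite lee_fin add0r -(ler_pM2l k0); apply: (le_trans (abG w)).
        have -> : k * ((2 * k)^-1 * G w) = 2^-1 * G w by field; rewrite gt_eqF.
        rewrite ler_pM2l//; have := expR_ge1Dx (k * a w ^+ 2); have := expR_ge1Dx (k * b w ^+ 2).
        rewrite /G; lra.
    apply: integral_affine_le => //; first by rewrite invr_ge0 mulr_ge0// ltW.
  move: h; rewrite lee_fin add0r -(ler_pM2l k0).
  rewrite (_ : k * ((2 * k)^-1 * 4) = 2)//; field; by rewrite gt_eqF.
pose W w := a w * b w - c.
have mW : measurable_fun setT W by apply: measurable_funB => //; exact: measurable_funM.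
pose q := u ^+ 2 / k ^+ 2.
have q0 : 0 <= q by rewrite divr_ge0 ?sqr_ge0.
apply: (@le_trans _ _ (\int[P]_w (1 + 64 * q * G w)%:E)%E); last first.
  apply: (le_trans (integral_affine_le mG G0 ler01 (mulr_ge0 (ler0n _ 64) q0) IG)).
  rewrite lee_fin; apply: le_trans (expR_ge1Dx _); rewrite -/q; lra.
apply: (@le_integral_centered _ _ _ P (fun w => u * W w)) => //.
- rewrite (_ : _ \o _ = (fun w => u%:E * (W w)%:E)%E)//; apply: integrableZl => //.
  rewrite (_ : (fun _ => _) = (EFin \o (fun w => (a w * b w)%R)) \- (EFin \o cst c))%E//.
  by apply: integrableB => //; exact: finite_measure_integrable_cst.
- have iW : P.-integrable setT (EFin \o W).
    rewrite (_ : _ \o _ = (EFin \o (fun w => (a w * b w)%R)) \- (EFin \o cst c))%E//.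
    by apply: integrableB => //; exact: finite_measure_integrable_cst.
  rewrite /expect RintegralZl// RintegralB//; last exact: finite_measure_integrable_cst.
  have -> : (\int[P]_w cst c w)%R = c by rewrite /Rintegral integral_cst_prob.
  by rewrite -/(expect P _) -/c subrr mulr0.
- by apply: measurableT_comp => //; apply: measurable_funM.
- by apply: measurable_funD => //; apply: measurable_funM.
- by move=> w; rewrite addr_ge0// mulr_ge0// mulr_ge0.
move=> w; rewrite -/(W w).
have W0 := normr_ge0 (W w).
have nu : `|u * W w| <= k / 2 * `|W w| by rewrite normrM ler_wpM2r.
apply: (le_trans (expR_le_taylor2 _)); rewrite [1 + _]addrC -addrA lerD2l lerD2l.
(* Half of the rate [k] pays for the factor [W w ^+ 2], through [v ^+ 2 <= 2 * expR v], the other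
   half for [expR |u W|]. Then [expR (k |W|) <= 8 * G w], and the mean of [G], at most 4, yields 256
   = 8 * 8 * 4. *)
apply: (@le_trans _ _ (8 * q * expR (k * `|W w|))).
  have -> : k * `|W w| = k / 2 * `|W w| + k / 2 * `|W w| by field.
  rewrite expRD mulrA; apply: ler_pM; rewrite ?sqr_ge0 ?expR_ge0 ?ler_expR//.
  have h := @pow_le_fact_expR R 2 (k / 2 * `|W w|) (mulr_ge0 (divr_ge0 (ltW k0) (ler0n _ 2)) W0).
  have c0 : 0 <= 4 * q by rewrite mulr_ge0.
  have h' : 4 * q * (k / 2 * `|W w|) ^+ 2 <= 8 * q * expR (k / 2 * `|W w|).
    by have := ler_wpM2l c0 h; rewrite (_ : 2`!%:R = 2 :> R)// => h'; lra.
  apply: le_trans h'; rewrite !exprMn real_normK ?num_real// /q le_eqVlt.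
  by apply/orP; left; apply/eqP; field; rewrite gt_eqF.
have -> : 64 * q * G w = 8 * q * (8 * G w) by ring.
have q8 : 0 <= 8 * q by exact: mulr_ge0.
rewrite ler_wpM2l//.
have kW : k * `|W w| <= 2^-1 * (k * a w ^+ 2 + k * b w ^+ 2) + 2.
  have : k * `|W w| <= k * (`|a w * b w| + `|c|) by rewrite ler_pM2l// ler_normB.
  by rewrite mulrDr; have := abG w; lra.
apply: (@le_trans _ _ (expR (2^-1 * (k * a w ^+ 2 + k * b w ^+ 2)) * expR 2)).
  by rewrite -expRD ler_expR.
have e2 : expR 2 <= 16 :> R.
  rewrite (_ : 2 = 1 + 1 :> R)// expRD; have := @expR1_le4 R; have := expR_gt0 (1 : R); nra.
have eab : expR (2^-1 * (k * a w ^+ 2 + k * b w ^+ 2)) <= 2^-1 * G w.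
  rewrite mulrDr expRD /G.
  have -> : expR (k * a w ^+ 2) = expR (2^-1 * (k * a w ^+ 2)) ^+ 2.
    by rewrite -expRM_natl; congr expR; field.
  have -> : expR (k * b w ^+ 2) = expR (2^-1 * (k * b w ^+ 2)) ^+ 2.
    by rewrite -expRM_natl; congr expR; field.
  have := sqr_ge0 (expR (2^-1 * (k * a w ^+ 2)) - expR (2^-1 * (k * b w ^+ 2))).
  nra.
have -> : 8 * G w = 2^-1 * G w * 16 by field.
by apply: ler_pM; rewrite ?expR_ge0.
Qed.

End SubGaussian.

(** * Columns of the random matrix *)

Section Expect.
Context {d : measure_display} {T : measurableType d} {R : realType}.
Context (P : probability T R).

Lemma expectZ (c : R) (f : T -> R) : P.-integrable setT (EFin \o f) ->
  expect P (fun w => c * f w) = c * expect P f.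
Proof. by move=> fi; rewrite /expect RintegralZl. Qed.

Lemma integrable_mulcst (c : R) (f : T -> R) : P.-integrable setT (EFin \o f) ->
  P.-integrable setT (EFin \o (fun w => c * f w)).
Proof.
move=> fi; rewrite (_ : _ \o _ = (fun w => c%:E * (f w)%:E)%E)//.
exact: integrableZl.
Qed.

Lemma integrable_sumR (I : Type) (r : seq I) (f : I -> T -> R) :
  (forall i, P.-integrable setT (EFin \o f i)) ->
  P.-integrable setT (EFin \o (fun w => \sum_(i <- r) f i w)).
Proof.
move=> fi; rewrite (_ : _ \o _ = (fun w => \sum_(i <- r) (f i w)%:E)%E).
  by apply: integrable_sum => // i _; exact: fi.
by apply/funext => w /=; rewrite sumEFin.
Qed.

Lemma expect_sum (I : Type) (r : seq I) (f : I -> T -> R) :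
  (forall i, P.-integrable setT (EFin \o f i)) ->
  expect P (fun w => \sum_(i <- r) f i w) = \sum_(i <- r) expect P (f i).
Proof.
move=> fi; elim: r => [|i r IH].
  rewrite big_nil /expect /Rintegral; under eq_integral do rewrite big_nil.
  by rewrite integral0.
rewrite big_cons -IH /expect -RintegralD//; last exact: integrable_sumR.
by apply: eq_Rintegral => w _; rewrite big_cons.
Qed.

End Expect.

Section IndependentSums.
Context {d : measure_display} {T : measurableType d} {R : realType}.
Context (P : probability T R).

Lemma prode_le (I : finType) (Q : pred I) (f : I -> \bar R) (c : I -> R) :
  (forall i, Q i -> 0 <= f i)%E -> (forall i, Q i -> f i <= (c i)%:E)%E ->
  (\prod_(i | Q i) f i <= (\prod_(i | Q i) c i)%:E)%E.
Proof.
move=> f0 fc.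
suff : (0 <= \prod_(i | Q i) f i <= (\prod_(i | Q i) c i)%:E)%E by case/andP.
apply: (big_ind2 (fun (x : \bar R) (y : R) => 0 <= x <= y%:E)%E).
- by rewrite lee_fin ler01 lexx.
- move=> x1 x2 y1 y2 /andP[x10 x12] /andP[y10 y12].
  by rewrite mule_ge0//= EFinM lee_pmul.
- by move=> i Qi; rewrite f0// fc.
Qed.

Lemma mgf_sum (I : finType) (X : I -> T -> R) (s : I -> R) (Q : pred I)
    (theta : I -> R) (t : R) :
  mutually_independent P X -> (forall i, 0 < s i) ->
  (forall i, P.-integrable setT (EFin \o X i)) ->
  (forall i, expect P (X i) = 0) ->
  (forall i, \int[P]_w (expR ((X i w / s i) ^+ 2))%:E <= 2%:E)%E ->
  (\int[P]_w (expR (t * \sum_(i | Q i) theta i * X i w))%:E <=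
    (expR (2 * (t ^+ 2 * \sum_(i | Q i) theta i ^+ 2 * s i ^+ 2)))%:E)%E.
Proof.
move=> indep s0 iX EX Xs.
have -> : (\int[P]_w (expR (t * \sum_(i | Q i) theta i * X i w))%:E =
    \int[P]_w (\prod_(i | Q i) expR (t * theta i * X i w))%:E)%E.
  apply: eq_integral => w _; rewrite mulr_sumr expR_sum; congr EFin.
  by apply: eq_bigr => i _; rewrite mulrA.
rewrite (integral_indep_prod indep (c := id)); last 2 first.
- move=> i _; apply: (measurableT_comp (@measurable_expR R)); apply: measurable_funM.
    exact: measurable_cst.
  by apply: cylinder_measurable_coord; rewrite inE.
- by move=> i w _; exact: expR_ge0.
apply: (@le_trans _ _ ((\prod_(i | Q i) expR (2 * ((t * theta i) ^+ 2 * s i ^+ 2)))%:E)).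
  apply: prode_le => i _; first by apply: integral_ge0 => w _; rewrite lee_fin expR_ge0.
  exact: mgf_le_of_exp_sqr.
rewrite -expR_sum lee_fin ler_expR -mulr_sumr ler_pM2l// mulr_sumr.
by apply: ler_sum => i _; rewrite exprMn mulrA.
Qed.

Context (p n : nat) (Z : 'I_p -> 'I_n -> T -> R) (s : 'I_p -> R).
Hypothesis indep : mutually_independent P (fun ij : 'I_p * 'I_n => Z ij.1 ij.2).
Hypothesis iZ : forall i j, P.-integrable setT (EFin \o Z i j).
Hypothesis EZ : forall i j, expect P (Z i j) = 0.
Hypothesis s0 : forall i, 0 < s i.
Hypothesis Zs : forall i j, (\int[P]_w (expR ((Z i j w / s i) ^+ 2))%:E <= 2%:E)%E.

Let combo (theta : 'I_p -> R) j w := \sum_i theta i * Z i j w.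

Let mZ i j : measurable_fun setT (Z i j).
Proof. by apply/measurable_EFinP; exact: measurable_int (iZ i j). Qed.

Let mcombo theta j : measurable_fun setT (combo theta j).
Proof. by apply: measurable_sum => i; apply: measurable_funM. Qed.

Let pair_sum (F : 'I_p * 'I_n -> R) j : \sum_(ij | ij.2 == j) F ij = \sum_i F (i, j).
Proof.
rewrite (reindex_onto (fun i => (i, j)) fst).
  by apply: eq_bigl => i; rewrite /= !eqxx.
by case=> i k /= /eqP ->.
Qed.

Let mgf_combo theta j (t : R) :
  (\int[P]_w (expR (t * combo theta j w))%:E <=
    (expR (2 * (t ^+ 2 * \sum_i theta i ^+ 2 * s i ^+ 2)))%:E)%E.
Proof.
have := @mgf_sum _ (fun ij : 'I_p * 'I_n => Z ij.1 ij.2) (fun ij => s ij.1)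
  (fun ij => ij.2 == j) (fun ij => theta ij.1) t indep
  (fun ij => s0 ij.1) (fun ij => iZ ij.1 ij.2) (fun ij => EZ ij.1 ij.2)
  (fun ij => Zs ij.1 ij.2).
rewrite pair_sum/=; congr (_ <= _)%E; apply: eq_integral => w _.
by rewrite pair_sum.
Qed.

(** Within a column the two combinations are sub-Gaussian with proxy [V], so their product falls
    under [mgf_centered_mul] at rate [1 / (48 * V)]; distinct columns are independent, hence the
    factor [n] in the exponent. *)
Lemma mgf_bilinear (theta eta : 'I_p -> R) (V u : R) : 0 < V ->
  \sum_i theta i ^+ 2 * s i ^+ 2 <= V -> \sum_i eta i ^+ 2 * s i ^+ 2 <= V ->
  `|u| <= (48 * V)^-1 / 2 ->
  (\int[P]_w (expR (u * \sum_j (combo theta j w * combo eta j w -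
       expect P (fun w => combo theta j w * combo eta j w)%R)))%:E <=
    (expR (n%:R * (256 * (u ^+ 2 / (48 * V)^-1 ^+ 2))))%:E)%E.
Proof.
move=> V0 thV etV uV.
have k0 : 0 < (48 * V)^-1 by rewrite invr_gt0 mulr_gt0.
have exps (th : 'I_p -> R) j : \sum_i th i ^+ 2 * s i ^+ 2 <= V ->
    (\int[P]_w (expR ((48 * V)^-1 * combo th j w ^+ 2))%:E <= 2%:E)%E.
  move=> thV'; apply: exp_sqr_le_of_mgf => // t; apply: (le_trans (mgf_combo th j t)).
  by rewrite lee_fin ler_expR ler_pM2l// ler_wpM2l// sqr_ge0.
pose c j := expect P (fun w => combo theta j w * combo eta j w).
have -> : (\int[P]_w (expR (u * \sum_j (combo theta j w * combo eta j w - c j)))%:E =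
    \int[P]_w (\prod_j expR (u * (combo theta j w * combo eta j w - c j)))%:E)%E.
  by apply: eq_integral => w _; rewrite mulr_sumr expR_sum.
have mcyl (th : 'I_p -> R) j : cylinder_measurable (fun ij : 'I_p * 'I_n => Z ij.1 ij.2)
    [set ij | ij.2 == j]%SET (combo th j).
  apply: measurable_sum => i; apply: measurable_funM; first exact: measurable_cst.
  by apply: (cylinder_measurable_coord _ (i := (i, j))); rewrite inE.
rewrite (integral_indep_prod indep (c := snd)); last 2 first.
- move=> j _; apply: (measurableT_comp (@measurable_expR R)); apply: measurable_funM.
    exact: measurable_cst.
  apply: measurable_funB; last exact: measurable_cst.
  by apply: measurable_funM; exact: mcyl.
- by move=> i w _; exact: expR_ge0.
apply: (@le_trans _ _ ((\prod_(j < n) expR (256 * (u ^+ 2 / (48 * V)^-1 ^+ 2)))%:E)).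
  apply: prode_le => j _; first by apply: integral_ge0 => w _; rewrite lee_fin expR_ge0.
  apply: mgf_centered_mul => //; exact: exps.
by rewrite prodr_const card_ord [in leRHS]expRM_natl lexx.
Qed.

(** Both the Gram matrix and its mean are sums over columns. The exponential square moments make
    products of entries integrable, so expectation commutes with the finite sums. *)
Lemma bilinear_centered (theta eta : 'I_p -> R) w :
  let ZZt := fun w => (\matrix_(i, j) Z i j w) *m (\matrix_(i, j) Z i j w)^T in
  let EZZt := \matrix_(i, k) expect P (fun w => ZZt w i k) in
  \sum_i \sum_k theta i * (ZZt w - EZZt) i k * eta k =
  \sum_j (combo theta j w * combo eta j w -
       expect P (fun w => combo theta j w * combo eta j w)%R).
Proof.
move=> ZZt EZZt.
have iZZ i k j : P.-integrable setT (EFin \o (fun w => Z i j w * Z k j w)).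
  have sq m : P.-integrable setT (EFin \o (fun w => Z m j w ^+ 2)).
    apply: (@integrable_sqr_of_exp_sqr _ _ _ _ _ (s m ^- 2)) => //.
      by rewrite invr_gt0 exprn_gt0.
    under eq_integral do rewrite mulrC -expr_div_n.
    exact: Zs.
  exact: integrable_mul_of_sqr.
have ZZtE i k : (fun w => ZZt w i k) = (fun w => \sum_j Z i j w * Z k j w).
  by apply/funext => v; rewrite !mxE; apply: eq_bigr => j _; rewrite !mxE.
have EE i k : EZZt i k = \sum_j expect P (fun w => Z i j w * Z k j w).
  by rewrite mxE ZZtE expect_sum.
have comboE j : (fun w => combo theta j w * combo eta j w) =
    (fun w => \sum_i \sum_k theta i * eta k * (Z i j w * Z k j w)).
  apply/funext => v; rewrite /combo mulr_suml; apply: eq_bigr => i _.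
  by rewrite mulr_sumr; apply: eq_bigr => k _; ring.
transitivity (\sum_j \sum_i \sum_k theta i * eta k *
   (Z i j w * Z k j w - expect P (fun w => Z i j w * Z k j w))).
  rewrite [RHS]exchange_big; apply: eq_bigr => i _.
  rewrite [RHS]exchange_big; apply: eq_bigr => k _.
  rewrite -mulr_sumr mulrAC; congr (_ * _).
  rewrite mxE [in X in _ + X]mxE EE (congr1 (fun f => f w) (ZZtE i k)).
  by rewrite -sumrB.
apply: eq_bigr => j _.
have -> : expect P (fun w => combo theta j w * combo eta j w) =
    \sum_i \sum_k theta i * eta k * expect P (fun w => Z i j w * Z k j w).
  rewrite comboE expect_sum; last first.
    by move=> i; apply: integrable_sumR => k; exact: integrable_mulcst.
  apply: eq_bigr => i _; rewrite expect_sum; last by move=> k; exact: integrable_mulcst.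
  by apply: eq_bigr => k _; rewrite expectZ.
rewrite (congr1 (fun f => f w) (comboE j)) -sumrB; apply: eq_bigr => i _.
by rewrite -sumrB; apply: eq_bigr => k _; rewrite mulrBr.
Qed.

End IndependentSums.

(** * Randomized rounding *)

(** Lagrange's identity: twice the difference of the two sides is the sum of squares of the 2 by 2
    minors. *)
Lemma cauchy_schwarz_sum (R : realDomainType) (I : finType) (a b : I -> R) :
  (\sum_i a i * b i) ^+ 2 <= (\sum_i a i ^+ 2) * (\sum_i b i ^+ 2).
Proof.
have h : 0 <= \sum_i \sum_j (a i * b j - a j * b i) ^+ 2.
  by apply: sumr_ge0 => i _; apply: sumr_ge0 => j _; exact: sqr_ge0.
have e : \sum_i \sum_j (a i * b j - a j * b i) ^+ 2 =
   ((\sum_i a i ^+ 2) * (\sum_i b i ^+ 2) - (\sum_i a i * b i) ^+ 2) *+ 2.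
  rewrite mulr2n.
  have e1 : (\sum_i a i ^+ 2) * (\sum_i b i ^+ 2) = \sum_i \sum_j a i ^+ 2 * b j ^+ 2.
    by rewrite mulr_suml; apply: eq_bigr => i _; rewrite mulr_sumr.
  have e2 : (\sum_i a i ^+ 2) * (\sum_i b i ^+ 2) = \sum_i \sum_j a j ^+ 2 * b i ^+ 2.
    by rewrite e1 exchange_big.
  have e3 : (\sum_i a i * b i) ^+ 2 = \sum_i \sum_j (a i * b i) * (a j * b j).
    by rewrite expr2 mulr_suml; apply: eq_bigr => i _; rewrite mulr_sumr.
  rewrite {1}e1 e2 e3 -!sumrB -big_split/=; apply: eq_bigr => i _.
  rewrite -!sumrB -big_split/=; apply: eq_bigr => j _; ring.
by move: h; rewrite e pmulrn_lge0// subr_ge0.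
Qed.

Section SignCube.
Context {R : realFieldType} (J : finType).
Implicit Types (a c : J -> R) (e : {ffun J -> bool}).

Definition sgnb (b : bool) : R := if b then 1 else -1.

(* The law on the cube under which the signs are independent with means [a j]. *)
Definition sign_law a e : R := \prod_j ((1 + sgnb (e j) * a j) / 2).

Lemma sign_law_ge0 a e : (forall j, `|a j| <= 1) -> 0 <= sign_law a e.
Proof.
move=> a1; apply: prodr_ge0 => j _; rewrite divr_ge0//.
by have := a1 j; rewrite ler_norml /sgnb => /andP[]; case: (e j); lra.
Qed.

Lemma sum_sign_law_prod a (f : J -> bool -> R) :
  \sum_e sign_law a e * \prod_j f j (e j) =
  \prod_j ((1 + a j) / 2 * f j true + (1 - a j) / 2 * f j false).
Proof.
transitivity (\prod_j \sum_b ((1 + sgnb b * a j) / 2 * f j b)).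
  rewrite bigA_distr_bigA; apply: eq_bigr => e _.
  by rewrite /sign_law -big_split.
by apply: eq_bigr => j _; rewrite big_bool/= mul1r mulN1r.
Qed.

Lemma sum_sign_law a : \sum_e sign_law a e = 1.
Proof.
under eq_bigr do rewrite -[sign_law _ _]mulr1.
transitivity (\sum_e sign_law a e * \prod_(j : J) 1).
  by apply: eq_bigr => e _; rewrite big1.
rewrite (sum_sign_law_prod a (fun _ _ => 1)) big1// => j _.
by field.
Qed.

Lemma sign_law_cov a j k :
  \sum_e sign_law a e * ((sgnb (e j) - a j) * (sgnb (e k) - a k)) =
  if j == k then 1 - a j ^+ 2 else 0.
Proof.
(* Both centered signs written as one product over the cube, valid also for [j = k], so that the law
   factorizes. *)
pose f l b : R := (if l == j then sgnb b - a l else 1) * (if l == k then sgnb b - a l else 1).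
transitivity (\sum_e sign_law a e * \prod_l f l (e l)).
  apply: eq_bigr => e _; congr (_ * _); rewrite big_split/=; congr (_ * _).
    by rewrite (bigD1 j)//= eqxx big1 ?mulr1// => l /negbTE ->.
  by rewrite (bigD1 k)//= eqxx big1 ?mulr1// => l /negbTE ->.
rewrite sum_sign_law_prod (bigD1 j)//= /f eqxx.
case: eqVneq => [->|jk].
  rewrite big1 ?mulr1 /=; first by field.
  by move=> l lk; rewrite (negbTE lk); field.
by rewrite [X in X * _](_ : _ = 0) ?mul0r//=; field.
Qed.

Lemma sign_law_variance a c :
  \sum_e sign_law a e * (\sum_j c j * (sgnb (e j) - a j)) ^+ 2 <= \sum_j c j ^+ 2.
Proof.
have -> : \sum_e sign_law a e * (\sum_j c j * (sgnb (e j) - a j)) ^+ 2 =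
    \sum_j \sum_k c j * c k * (if j == k then 1 - a j ^+ 2 else 0).
  under [RHS]eq_bigr => j _ do under eq_bigr => k _ do rewrite -sign_law_cov mulr_sumr.
  under [RHS]eq_bigr => j _ do rewrite exchange_big.
  rewrite [RHS]exchange_big; apply: eq_bigr => e _ /=.
  rewrite expr2 mulr_suml mulr_sumr; apply: eq_bigr => j _.
  by rewrite !mulr_sumr; apply: eq_bigr => k _; ring.
apply: ler_sum => j _; rewrite (bigD1 j)//= eqxx big1 ?addr0; last first.
  by move=> k; rewrite eq_sym => /negbTE ->; rewrite mulr0.
by rewrite -expr2 ler_piMr ?sqr_ge0// gerBl sqr_ge0.
Qed.

(** The left side is one plus the chi-square divergence from the uniform law: one copy of the law is
    kept, the other, scaled by the power of 2, is the density. *)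
Lemma sign_law_sqr a : 2 ^+ #|J| * \sum_e sign_law a e ^+ 2 = \prod_j (1 + a j ^+ 2).
Proof.
rewrite mulr_sumr.
transitivity (\sum_e sign_law a e * \prod_j (1 + sgnb (e j) * a j)).
  apply: eq_bigr => e _; rewrite expr2 mulrCA; congr (_ * _).
  rewrite /sign_law -prodr_const -big_split/=; apply: eq_bigr => j _.
  by field.
rewrite (sum_sign_law_prod a (fun j b => 1 + sgnb b * a j)).
by apply: eq_bigr => j _ /=; field.
Qed.

End SignCube.

Section RandomizedRounding.
Context {R : realType} (p N : nat) (s : 'I_p -> R) (m : R).
Hypothesis N64 : (64 <= N)%N.
Hypothesis m0 : 0 < m.
Hypothesis s_ge0 : forall i, 0 <= s i.
Hypothesis s_le : forall i, s i <= m.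
Hypothesis s_sum : \sum_i s i ^+ 2 <= N%:R * m ^+ 2.

Let J := ('I_p * 'I_N)%type.
Let cube := {ffun J -> bool}.

Definition rounded (e : cube) (i : 'I_p) : R := N%:R^-1 * \sum_k sgnb (e (i, k)).

(** The threshold is 64 times the bound [4 * m ^+ 2] on the mean, so that Markov loses mass at most
    1/64. *)
Definition small_rounded (e : cube) : bool :=
  \sum_i rounded e i ^+ 2 * s i ^+ 2 <= 256 * m ^+ 2.

Let law (x : 'I_p -> R) := sign_law (fun j : J => x j.1).

(** The restricted law is not renormalised: the mean stays a plain sum, and the missing mass is part
    of its distance to [x]. *)
Definition rounded_mean (x : 'I_p -> R) (i : 'I_p) : R :=
  \sum_(e | small_rounded e) law x e * rounded e i.

Let N_gt0 : 0 < N%:R :> R.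
Proof. by rewrite ltr0n (leq_trans _ N64). Qed.

Let invN : N%:R^-1 <= 64^-1 :> R.
Proof. by rewrite lef_pV2 ?posrE// ler_nat. Qed.

Section FixVector.
Context (x : 'I_p -> R).
Hypothesis x1 : \sum_i x i ^+ 2 = 1.

Let x_le1 i : `|x i| <= 1.
Proof.
rewrite -(@ler_pXn2r _ 2) ?nnegrE// expr1n real_normK ?num_real// -x1.
by rewrite (bigD1 i)//= lerDl sumr_ge0// => j _; exact: sqr_ge0.
Qed.

Let law_ge0 e : 0 <= law x e.
Proof. by apply: sign_law_ge0 => j; exact: x_le1. Qed.

Lemma rounded_variance (u : 'I_p -> R) :
  \sum_e law x e * (\sum_i u i * (rounded e i - x i)) ^+ 2 <= N%:R^-1 * \sum_i u i ^+ 2.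
Proof.
have -> : \sum_e law x e * (\sum_i u i * (rounded e i - x i)) ^+ 2 =
    \sum_e law x e * (\sum_(j : J) (N%:R^-1 * u j.1) * (sgnb (e j) - x j.1)) ^+ 2.
  apply: eq_bigr => e _; congr (_ * _ ^+ 2).
  transitivity (\sum_i \sum_(k < N) N%:R^-1 * u i * (sgnb (e (i, k)) - x i)).
    apply: eq_bigr => i _; rewrite -mulr_sumr sumrB sumr_const card_ord /rounded.
    by rewrite -mulr_natl; field; rewrite gt_eqF.
  by rewrite pair_bigA; apply: eq_bigr => -[i k] _.
apply: (le_trans (sign_law_variance _ _)).
rewrite -(pair_bigA _ (fun i k => (N%:R^-1 * u i) ^+ 2))/= mulr_sumr.
apply: ler_sum => i _; rewrite sumr_const card_ord -mulr_natl exprMn.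
by rewrite le_eqVlt; apply/orP; left; apply/eqP; field; rewrite gt_eqF.
Qed.

Lemma rounded_coord_variance i :
  \sum_e law x e * (rounded e i - x i) ^+ 2 <= N%:R^-1.
Proof.
have := rounded_variance (fun k => (k == i)%:R).
have -> : \sum_k ((k == i)%:R : R) ^+ 2 = 1.
  by rewrite (bigD1 i)//= eqxx expr1n big1 ?addr0// => k /negbTE ->; rewrite expr0n.
rewrite mulr1; congr (_ <= _); apply: eq_bigr => e _; congr (_ * _ ^+ 2).
by rewrite (bigD1 i)//= eqxx mul1r big1 ?addr0// => k /negbTE ->; rewrite mul0r.
Qed.

(** Markov's inequality. Bounding a square by twice the fluctuation plus twice the mean, the
    fluctuations cost [2 * m ^+ 2] by [s_sum], and the vector [x] costs [2 * m ^+ 2] by [s_le]. *)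
Lemma law_not_small : \sum_(e | ~~ small_rounded e) law x e <= 64^-1.
Proof.
have tot : \sum_e law x e * (\sum_i rounded e i ^+ 2 * s i ^+ 2) <= 4 * m ^+ 2.
  apply: (@le_trans _ _ (\sum_e \sum_i (2 * s i ^+ 2 * (law x e * (rounded e i - x i) ^+ 2)
       + 2 * s i ^+ 2 * (law x e * x i ^+ 2)))).
    apply: ler_sum => e _; rewrite mulr_sumr; apply: ler_sum => i _.
    have L0 : 0 <= s i ^+ 2 * law x e by rewrite mulr_ge0// sqr_ge0.
    have h : rounded e i ^+ 2 <= 2 * (rounded e i - x i) ^+ 2 + 2 * x i ^+ 2.
      by have := sqr_ge0 (rounded e i - 2 * x i); nra.
    by have := ler_wpM2l L0 h; lra.
  rewrite exchange_big/=.
  apply: (@le_trans _ _ (\sum_i (2 * N%:R^-1 * s i ^+ 2 + 2 * m ^+ 2 * x i ^+ 2))).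
    apply: ler_sum => i _; rewrite big_split/= -!mulr_sumr -mulr_suml sum_sign_law mul1r.
    have s2 : 0 <= 2 * s i ^+ 2 by rewrite mulr_ge0// sqr_ge0.
    have sm : s i ^+ 2 <= m ^+ 2 by rewrite lerXn2r ?nnegrE// ltW.
    have := ler_wpM2l s2 (rounded_coord_variance i).
    have := ler_wpM2r (sqr_ge0 (x i)) sm; lra.
  rewrite big_split/= -!mulr_sumr x1 mulr1.
  have : N%:R^-1 * (\sum_i s i ^+ 2) <= m ^+ 2 by rewrite ler_pdivrMl.
  by rewrite -mulrA; lra.
have m2 : 0 < m ^+ 2 by rewrite exprn_gt0.
have h : 256 * m ^+ 2 * \sum_(e | ~~ small_rounded e) law x e <= 4 * m ^+ 2.
  apply: le_trans tot; rewrite mulr_sumr [leLHS]big_mkcond/=; apply: ler_sum => e _.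
  have t0 : 0 <= \sum_i rounded e i ^+ 2 * s i ^+ 2.
    by apply: sumr_ge0 => i _; rewrite mulr_ge0 ?sqr_ge0.
  case: ifP => [|_]; last by rewrite mulr_ge0.
  by rewrite -ltNge [leLHS]mulrC => /ltW ?; exact: ler_wpM2l.
rewrite -(@ler_pM2l _ (256 * m ^+ 2)) ?mulr_gt0//; lra.
Qed.

(** The bias is tested against itself, so only the variance in a single direction enters; adding
    coordinate variances would cost p / N. Its norm is at most 1/64 from the lost mass plus 1/8 from
    the fluctuations kept, since N is at least 64. *)
Lemma rounded_mean_dist : \sum_i (x i - rounded_mean x i) ^+ 2 <= 4^-1 ^+ 2.
Proof.
pose dl i := x i - rounded_mean x i.
pose D := \sum_i dl i ^+ 2.
pose pb := \sum_(e | ~~ small_rounded e) law x e.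
pose v e := \sum_i dl i * (rounded e i - x i).
have D0 : 0 <= D by apply: sumr_ge0 => i _; exact: sqr_ge0.
have DE : D = pb * (\sum_i dl i * x i) - \sum_(e | small_rounded e) law x e * v e.
  have pg : \sum_(e | small_rounded e) law x e = 1 - pb.
    have h : \sum_e law x e = 1 by exact: sum_sign_law.
    by rewrite -h [in RHS](bigID small_rounded)/= -/pb addrK.
  have -> : \sum_(e | small_rounded e) law x e * v e =
      \sum_i dl i * (rounded_mean x i - (1 - pb) * x i).
    under eq_bigr => e _ do rewrite /v mulr_sumr.
    rewrite exchange_big; apply: eq_bigr => i _ /=.
    rewrite -pg mulr_suml -sumrB mulr_sumr; apply: eq_bigr => e _; ring.
  rewrite mulr_sumr -sumrB; apply: eq_bigr => i _; rewrite /dl; ring.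
have pb0 : 0 <= pb by apply: sumr_ge0.
have pb1 : pb <= 64^-1 by exact: law_not_small.
have cs1 : (\sum_i dl i * x i) ^+ 2 <= D.
  by apply: (le_trans (cauchy_schwarz_sum _ _)); rewrite x1 mulr1.
have cs2 : (\sum_(e | small_rounded e) law x e * v e) ^+ 2 <= 64^-1 * D.
  have -> : \sum_(e | small_rounded e) law x e * v e =
      \sum_e (Num.sqrt (law x e) * (small_rounded e)%:R) * (Num.sqrt (law x e) * v e).
    rewrite big_mkcond; apply: eq_bigr => e _; rewrite mulrACA -expr2 sqr_sqrtr//.
    by case: ifP => _; rewrite ?mul1r// mul0r mulr0.
  apply: (le_trans (cauchy_schwarz_sum _ _)).
  apply: (@le_trans _ _ (1 * (N%:R^-1 * D))); last by rewrite mul1r ler_wpM2r.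
  apply: ler_pM.
  - by apply: sumr_ge0 => e _; exact: sqr_ge0.
  - by apply: sumr_ge0 => e _; exact: sqr_ge0.
  - rewrite -[leRHS](sum_sign_law (fun j : J => x j.1)); apply: ler_sum => e _.
    rewrite exprMn sqr_sqrtr// -natrX.
    by case: small_rounded; rewrite ?mulr1 ?mulr0 //; exact: law_ge0.
  - apply: le_trans (rounded_variance dl); apply: ler_sum => e _.
    by rewrite exprMn sqr_sqrtr.
set A := (\sum_i dl i * x i) in DE cs1; set B := (\sum_(e | _) _) in DE cs2.
rewrite -/D; clearbody D A B.
have [D1|D1] := ltP 0 D; last by apply: (le_trans D1); lra.
pose r := Num.sqrt D.
have r2 : r ^+ 2 = D by rewrite sqr_sqrtr.
have r0 : 0 < r by rewrite sqrtr_gt0.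
have Ar : A <= r by rewrite leNgt; apply/negP => h; nra.
have Br : - B <= 8^-1 * r by rewrite leNgt; apply/negP => h; nra.
have pA : pb * A <= 64^-1 * r.
  apply: (@le_trans _ _ (pb * r)); first exact: ler_wpM2l.
  by rewrite ler_wpM2r// ltW.
have : r * r <= 4^-1 * r by rewrite -expr2 r2 DE; lra.
by rewrite ler_pM2r// => r4; rewrite -r2 lerXn2r// ?nnegrE// ltW.
Qed.

Lemma exp_sum_density :
  2 ^+ #|{: J}| * \sum_e law x e ^+ 2 <= expR N%:R.
Proof.
rewrite sign_law_sqr -(pair_bigA _ (fun i k => 1 + x i ^+ 2))/=.
have -> : N%:R = \sum_i \sum_(k < N) x i ^+ 2.
  under eq_bigr do rewrite sumr_const card_ord -mulr_natl.
  by rewrite -mulr_sumr x1 mulr1.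
rewrite expR_sum; apply: ler_prod => i _; rewrite prodr_ge0/=; last first.
  by move=> k _; rewrite addr_ge0 ?sqr_ge0.
rewrite expR_sum; apply: ler_prod => k _.
by rewrite addr_ge0 ?sqr_ge0//= expR_ge1Dx.
Qed.

End FixVector.

Definition bilin (M : 'M[R]_p) (a b : 'I_p -> R) : R :=
  \sum_i \sum_k a i * M i k * b k.

(** Normalised by all pairs of cube points, although only small roundings are summed. *)
Definition partition_fun (M : 'M[R]_p) (l : R) : R :=
  4 ^- #|{: J}| * \sum_(e | small_rounded e) \sum_(f | small_rounded f)
    expR (2 * l * bilin M (rounded e) (rounded f)).

Lemma bilin_rounded_mean (M : 'M[R]_p) x y :
  bilin M (rounded_mean x) (rounded_mean y) =
  \sum_(e | small_rounded e) \sum_(f | small_rounded f)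
    law x e * law y f * bilin M (rounded e) (rounded f).
Proof.
rewrite /bilin /rounded_mean.
transitivity (\sum_i \sum_k \sum_(e | small_rounded e) \sum_(f | small_rounded f)
   law x e * law y f * (rounded e i * M i k * rounded f k)).
  apply: eq_bigr => i _; apply: eq_bigr => k _.
  rewrite mulr_suml mulr_suml; apply: eq_bigr => e _.
  by rewrite mulr_sumr; apply: eq_bigr => f _; ring.
under eq_bigr => i _ do rewrite exchange_big.
rewrite exchange_big; apply: eq_bigr => e _ /=.
under eq_bigr => i _ do rewrite exchange_big.
rewrite exchange_big; apply: eq_bigr => f _ /=.
rewrite mulr_sumr; apply: eq_bigr => i _.
by rewrite mulr_sumr.
Qed.

(* The Gibbs variational principle, in the form
   [r t <= r K + r exp (t - K)] and AM-GM on the last term. *)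
Lemma bilin_rounded_mean_le (M : 'M[R]_p) (l L : R) x y :
  \sum_i x i ^+ 2 = 1 -> \sum_i y i ^+ 2 = 1 -> 0 <= L ->
  l * bilin M (rounded_mean x) (rounded_mean y) <=
  N%:R + L / 2 + 2^-1 + 2^-1 * expR (- L) * partition_fun M l.
Proof.
move=> x1 y1 L0; rewrite bilin_rounded_mean.
have lx0 e : 0 <= law x e.
  apply: sign_law_ge0 => j; rewrite -(@ler_pXn2r _ 2) ?nnegrE// expr1n real_normK ?num_real// -x1.
  by rewrite (bigD1 j.1)//= lerDl sumr_ge0// => i _; exact: sqr_ge0.
have ly0 e : 0 <= law y e.
  apply: sign_law_ge0 => j; rewrite -(@ler_pXn2r _ 2) ?nnegrE// expr1n real_normK ?num_real// -y1.
  by rewrite (bigD1 j.1)//= lerDl sumr_ge0// => i _; exact: sqr_ge0.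
(* [N] pays for the second moments of the two densities, whose product is at most [A]; after
   squaring, [L / 2] becomes the free factor [expR (- L)]. *)
pose K : R := N%:R + L / 2.
pose D : R := 2 ^+ #|{: J}|.
have D0 : 0 < D by rewrite exprn_gt0.
pose A : R := expR (2 * N%:R).
have A0 : 0 < A by exact: expR_gt0.
have K0 : 0 <= K by rewrite addr_ge0// divr_ge0.
have AK : A * (expR (- K)) ^+ 2 = expR (- L).
  by rewrite -expRM_natl -expRD /K; congr expR; field.
have pt (r t : R) : 0 <= r ->
    r * t <= K * r + 2^-1 * (r ^+ 2 * D ^+ 2 / A) + 2^-1 * expR (- L) * (D ^- 2 * expR (2 * t)).
  move=> r0; rewrite -AK.
  have h1 : r * (t - K) <= r * expR (t - K).
    by rewrite ler_wpM2l//; have := expR_ge1Dx (t - K); lra.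
  (* AM-GM on [g * g']: over all small pairs the squares of [g] sum to at most 1 by
     [exp_sum_density], those of [g'] to [expR (- L)] times the partition function. *)
  pose g := r * D / Num.sqrt A; pose g' := Num.sqrt A / D * expR (t - K).
  have sA : Num.sqrt A ^+ 2 = A by rewrite sqr_sqrtr// ltW.
  have sA0 : 0 < Num.sqrt A by rewrite sqrtr_gt0.
  have e1 : r * expR (t - K) = g * g' by rewrite /g /g'; field; rewrite !gt_eqF.
  have e2 : g ^+ 2 = r ^+ 2 * D ^+ 2 / A by rewrite /g !exprMn exprVn sA.
  have e3 : g' ^+ 2 = A * expR (- K) ^+ 2 * (D ^- 2 * expR (2 * t)).
    rewrite /g' expRD !exprMn sA exprVn (_ : expR (2 * t) = expR t ^+ 2); first by ring.
    by rewrite -expRM_natl.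
  have e4 : 2^-1 * (A * expR (- K) ^+ 2) * (D ^- 2 * expR (2 * t)) = 2^-1 * g' ^+ 2.
    by rewrite e3; ring.
  by have := sqr_ge0 (g - g'); rewrite -e2 e4; move: h1; rewrite e1; lra.
have DD : D ^- 2 = 4 ^- #|{: J}| by rewrite /D -exprM mulnC exprM; congr (_ ^- _); ring.
rewrite mulr_sumr.
apply: (@le_trans _ _ (\sum_(e | small_rounded e) \sum_(f | small_rounded f)
  (K * (law x e * law y f) + 2^-1 * ((law x e * law y f) ^+ 2 * D ^+ 2 / A) +
   2^-1 * expR (- L) * (D ^- 2 * expR (2 * l * bilin M (rounded e) (rounded f)))))).
  apply: ler_sum => e _; rewrite mulr_sumr; apply: ler_sum => f _.
  by rewrite mulrCA -[2 * l * _]mulrA pt// mulr_ge0.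
under eq_bigr => e _ do rewrite !big_split/= -!mulr_sumr.
rewrite !big_split/= -!mulr_sumr.
have mono (F : cube -> R) : (forall e, 0 <= F e) -> \sum_(e | small_rounded e) F e <= \sum_e F e.
  move=> F0; rewrite [leLHS]big_mkcond; apply: ler_sum => e _.
  by case: ifP.
have B1 : \sum_(e | small_rounded e) law x e * (\sum_(f | small_rounded f) law y f) <= 1.
  rewrite -mulr_suml -[leRHS]mulr1.
  have sx : \sum_e law x e = 1 by exact: sum_sign_law.
  have sy : \sum_e law y e = 1 by exact: sum_sign_law.
  apply: ler_pM; [exact: sumr_ge0|exact: sumr_ge0| |].
    by rewrite -[leRHS]sx; exact: mono.
  by rewrite -[leRHS]sy; exact: mono.
have B2 : \sum_(e | small_rounded e) \sum_(f | small_rounded f)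
    (law x e * law y f) ^+ 2 * D ^+ 2 / A <= 1.
  have -> : \sum_(e | small_rounded e) \sum_(f | small_rounded f)
      (law x e * law y f) ^+ 2 * D ^+ 2 / A =
      (D * \sum_(e | small_rounded e) law x e ^+ 2) *
      (D * \sum_(f | small_rounded f) law y f ^+ 2) / A.
    rewrite mulrACA mulr_suml mulr_sumr mulr_suml; apply: eq_bigr => e _.
    rewrite mulr_sumr mulr_sumr mulr_suml; apply: eq_bigr => f _.
    by rewrite exprMn expr2; ring.
  rewrite ler_pdivrMr// mul1r /A (_ : 2 * N%:R = N%:R + N%:R); last by ring.
  rewrite expRD; apply: ler_pM.
  - by rewrite mulr_ge0 ?(ltW D0)// sumr_ge0// => e _; exact: sqr_ge0.
  - by rewrite mulr_ge0 ?(ltW D0)// sumr_ge0// => e _; exact: sqr_ge0.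
  - apply: le_trans (exp_sum_density x1); rewrite ler_pM2l//.
    by apply: mono => e; exact: sqr_ge0.
  - apply: le_trans (exp_sum_density y1); rewrite ler_pM2l//.
    by apply: mono => e; exact: sqr_ge0.
rewrite -/(partition_fun M l) /partition_fun -DD.
rewrite lerD2r; apply: lerD; first by have := ler_wpM2l K0 B1; rewrite mulr1.
by rewrite -[leRHS]mulr1 ler_pM2l.
Qed.

End RandomizedRounding.

(** * Spectral norm and absorption of the rounding error *)

Section SpectralNorm.
Context {R : realType}.

Lemma vnorm2_sqr n (v : 'cV[R]_n) : vnorm2 v ^+ 2 = \sum_i v i ord0 ^+ 2.
Proof. by rewrite sqr_sqrtr// sumr_ge0// => i _; exact: sqr_ge0. Qed.

Lemma vnorm2_ge0 n (v : 'cV[R]_n) : 0 <= vnorm2 v.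
Proof. exact: sqrtr_ge0. Qed.

Lemma dot_le_vnorm2 n (a b : 'cV[R]_n) :
  \sum_i a i ord0 * b i ord0 <= vnorm2 a * vnorm2 b.
Proof.
have h := cauchy_schwarz_sum (fun i => a i ord0) (fun i => b i ord0).
rewrite -!vnorm2_sqr -exprMn in h.
have ab0 : 0 <= vnorm2 a * vnorm2 b by rewrite mulr_ge0 ?vnorm2_ge0.
by rewrite leNgt; apply/negP => h'; nra.
Qed.

Lemma vnorm2Z n c (v : 'cV[R]_n) : vnorm2 (c *: v) = `|c| * vnorm2 v.
Proof.
rewrite /vnorm2; under eq_bigr do rewrite mxE exprMn.
by rewrite -mulr_sumr sqrtrM ?sqr_ge0// sqrtr_sqr.
Qed.

Lemma vnorm2_eq0 n (v : 'cV[R]_n) : vnorm2 v = 0 -> v = 0.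
Proof.
move=> v0; have := vnorm2_sqr v; rewrite v0 expr0n/= => /esym/eqP.
rewrite psumr_eq0; last by move=> i _; exact: sqr_ge0.
move=> /allP h; apply/matrixP => i j; rewrite (ord1 j) mxE.
by have := h i (mem_index_enum i); rewrite sqrf_eq0 => /eqP.
Qed.

Lemma specnorm_has_ubound m n (A : 'M[R]_(m, n)) :
  has_ubound [set vnorm2 (A *m x) | x in [set x : 'cV[R]_n | vnorm2 x = 1]].
Proof.
exists (Num.sqrt (\sum_i \sum_j A i j ^+ 2)) => _ [x /= x1 <-].
rewrite ler_wsqrtr//; apply: ler_sum => i _; rewrite mxE.
apply: (le_trans (cauchy_schwarz_sum _ _)).
by rewrite -vnorm2_sqr x1 expr1n mulr1.
Qed.

Lemma vnorm2_mul_le m n (A : 'M[R]_(m, n)) (v : 'cV[R]_n) :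
  vnorm2 (A *m v) <= specnorm A * vnorm2 v.
Proof.
have [v0|v0] := eqVneq (vnorm2 v) 0.
  by rewrite v0 (vnorm2_eq0 v0) mulmx0 mulr0 -(scale0r (0 : 'cV[R]_m)) vnorm2Z normr0 mul0r.
have vp : 0 < vnorm2 v by rewrite lt0r v0 vnorm2_ge0.
rewrite -ler_pdivrMr//.
have -> : vnorm2 (A *m v) / vnorm2 v = vnorm2 (A *m ((vnorm2 v)^-1 *: v)).
  by rewrite -scalemxAr vnorm2Z ger0_norm ?invr_ge0 ?vnorm2_ge0// mulrC.
apply: ub_le_sup; first exact: specnorm_has_ubound.
exists ((vnorm2 v)^-1 *: v) => //=.
by rewrite vnorm2Z ger0_norm ?invr_ge0 ?vnorm2_ge0// mulVf.
Qed.

(** The sign condition covers dimension zero, where the unit sphere is empty and the supremum takes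
    its default value 0. *)
Lemma specnorm_le m n (A : 'M[R]_(m, n)) c : 0 <= c ->
  (forall x, vnorm2 x = 1 -> vnorm2 (A *m x) <= c) -> specnorm A <= c.
Proof.
move=> c0 Ac; rewrite /specnorm; set E := [set _ | _ in _].
have [->|E0] := eqVneq E set0; first by rewrite sup0.
apply: ge_sup; first by apply/set0P.
by move=> _ [x /= x1 <-]; exact: Ac.
Qed.

Lemma specnorm_ge0 m n (A : 'M[R]_(m, n)) : 0 <= specnorm A.
Proof.
rewrite /specnorm; set E := [set _ | _ in _].
have [->|/set0P[y Ey]] := eqVneq E set0; first by rewrite sup0.
apply: le_trans (ub_le_sup (specnorm_has_ubound A) Ey).
by case: Ey => x _ <-; exact: vnorm2_ge0.
Qed.

Lemma bilinE p (M : 'M[R]_p) (a b : 'cV[R]_p) :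
  bilin M (a^~ ord0) (b^~ ord0) = \sum_i a i ord0 * (M *m b) i ord0.
Proof.
apply: eq_bigr => i _; rewrite mxE mulr_sumr; apply: eq_bigr => k _.
by rewrite mulrA.
Qed.

Lemma bilin_le p (M : 'M[R]_p) (a b : 'cV[R]_p) :
  bilin M (a^~ ord0) (b^~ ord0) <= specnorm M * (vnorm2 a * vnorm2 b).
Proof.
rewrite bilinE; apply: (le_trans (dot_le_vnorm2 _ _)).
by rewrite mulrCA ler_wpM2l ?vnorm2_ge0// vnorm2_mul_le.
Qed.

(** Deterministic, for one fixed matrix: afterwards randomness enters only through the partition
    function. The factor 16/7 is 1 / (1 - 9/16). *)
Lemma specnorm_le_partition_fun (p N : nat) (s : 'I_p -> R) (m : R)
    (M : 'M[R]_p) (l L : R) :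
  (64 <= N)%N -> 0 < m -> (forall i, 0 <= s i) -> (forall i, s i <= m) ->
  \sum_i s i ^+ 2 <= N%:R * m ^+ 2 -> 0 < l -> 0 <= L ->
  specnorm M <= 16 / 7 * (l^-1 * (N%:R + L / 2 + 2^-1 +
    2^-1 * expR (- L) * partition_fun N s m M l)).
Proof.
move=> N64 m0 s0 sm sN l0 L0; set Q := N%:R + _ + _ + _.
have Q0 : 0 <= Q.
  rewrite !addr_ge0// ?divr_ge0// mulr_ge0 ?mulr_ge0 ?expR_ge0 ?invr_ge0 ?exprn_ge0//.
  by apply: sumr_ge0 => e _; apply: sumr_ge0 => f _; exact: expR_ge0.
set B := specnorm M; have B0 : 0 <= B := specnorm_ge0 M.
have Ql0 : 0 <= l^-1 * Q by rewrite mulr_ge0// invr_ge0 ltW.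
suff : B <= 9 / 16 * B + l^-1 * Q by lra.
apply: specnorm_le; first by rewrite addr_ge0// mulr_ge0.
move=> y y1; have [My0|My0] := eqVneq (vnorm2 (M *m y)) 0.
  by rewrite My0 addr_ge0// mulr_ge0.
have Myp : 0 < vnorm2 (M *m y) by rewrite lt0r My0 vnorm2_ge0.
pose x := (vnorm2 (M *m y))^-1 *: (M *m y).
have x1 : vnorm2 x = 1 by rewrite vnorm2Z ger0_norm ?invr_ge0 ?vnorm2_ge0// mulVf.
have xMy : vnorm2 (M *m y) = bilin M (x^~ ord0) (y^~ ord0).
  rewrite bilinE; under eq_bigr do rewrite mxE -mulrA -expr2.
  by rewrite -mulr_sumr -vnorm2_sqr expr2 mulKf.
have sq1 (v : 'cV[R]_p) : vnorm2 v = 1 -> \sum_i v i ord0 ^+ 2 = 1.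
  by move=> v1; rewrite -vnorm2_sqr v1 expr1n.
pose mean (v : 'cV[R]_p) : 'cV[R]_p := \col_i rounded_mean N s m (v^~ ord0) i.
have meanE v : (mean v)^~ ord0 = rounded_mean N s m (v^~ ord0).
  by apply/funext => i; rewrite mxE.
have dist v : vnorm2 v = 1 -> vnorm2 (v - mean v) <= 4^-1.
  move=> v1; have := rounded_mean_dist N64 m0 s0 sm sN (sq1 v v1).
  rewrite (_ : \sum_i _ = vnorm2 (v - mean v) ^+ 2).
    by rewrite ler_pXn2r// ?nnegrE ?vnorm2_ge0.
  by rewrite vnorm2_sqr; apply: eq_bigr => i _; rewrite !mxE.
(* The last term carries its sign inside the first vector, so that [bilin_le], an upper bound,
   applies to it as well. *)
have dec : bilin M (x^~ ord0) (y^~ ord0) =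
   bilin M ((mean x)^~ ord0) ((mean y)^~ ord0)
   + bilin M ((x - mean x)^~ ord0) (y^~ ord0)
   + bilin M (x^~ ord0) ((y - mean y)^~ ord0)
   + bilin M ((- (x - mean x))^~ ord0) ((y - mean y)^~ ord0).
  rewrite /bilin -!big_split/=; apply: eq_bigr => i _.
  rewrite -!big_split/=; apply: eq_bigr => k _; rewrite !mxE; ring.
have main : bilin M ((mean x)^~ ord0) ((mean y)^~ ord0) <= l^-1 * Q.
  rewrite !meanE mulrC ler_pdivlMr// mulrC.
  by apply: bilin_rounded_mean_le => //; exact: sq1.
have dx := dist x x1; have dy := dist y y1.
have dx0 := vnorm2_ge0 (x - mean x); have dy0 := vnorm2_ge0 (y - mean y).
have b1 := bilin_le M (x - mean x) y.
have b2 := bilin_le M x (y - mean y).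
have b3 := bilin_le M (- (x - mean x)) (y - mean y).
rewrite -scaleN1r vnorm2Z normrN1 mul1r scaleN1r in b3.
rewrite x1 y1 !mulr1 !mul1r -/B in b1 b2 b3.
have c1 : B * vnorm2 (x - mean x) <= B * 4^-1 by exact: ler_wpM2l.
have c2 : B * vnorm2 (y - mean y) <= B * 4^-1 by exact: ler_wpM2l.
have c3 : B * (vnorm2 (x - mean x) * vnorm2 (y - mean y)) <= B * (4^-1 * 4^-1).
  by apply: ler_wpM2l => //; exact: ler_pM.
by rewrite xMy dec; lra.
Qed.

End SpectralNorm.

(** * Expected spectral norm *)

(** Factors: 16/7 from absorbing the error, 136 = 8 + 128 from the two halves of the bound at the
    chosen [u], 48 * 256 from the rate [k], and 64 from the choice of [N]. *)
Definition norm_const {R : realType} : R := 16 / 7 * (136 * (48 * 256) * 64).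

Lemma norm_const_gt0 (R : realType) : 0 < norm_const :> R.
Proof.
apply: mulr_gt0; first by rewrite divr_gt0 ?ltr0n.
by apply: mulr_gt0; [apply: mulr_gt0; [|apply: mulr_gt0]|]; rewrite ltr0n.
Qed.

Section ExpectedNorm.
Context {d : measure_display} {T : measurableType d} {R : realType}.
Context (P : probability T R).

(* No measurability is assumed: this spares proving that the spectral norm of a
   random matrix is measurable. *)
Lemma le_integral_ge0 (f g : T -> R) : (forall w, 0 <= f w) ->
  (forall w, f w <= g w) -> (\int[P]_w (f w)%:E <= \int[P]_w (g w)%:E)%E.
Proof.
move=> f0 fg.
rewrite !ge0_integralTE//; last by move=> w; rewrite lee_fin (le_trans (f0 w)).
apply: ereal_sup_le => _ [h hf <-]; exists h => // w.
by apply: (le_trans (hf w)); rewrite lee_fin.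
Qed.

Lemma measurable_sum_pred (I : finType) (Q : pred I) (f : I -> T -> R) :
  (forall i, measurable_fun setT (f i)) ->
  measurable_fun setT (fun w => \sum_(i | Q i) f i w).
Proof.
move=> mf; under eq_fun do rewrite -big_filter.
exact: measurable_sum.
Qed.

Lemma integral_sum_le (I : finType) (Q : pred I) (f : I -> T -> R) (c : R) :
  0 <= c -> (forall i, measurable_fun setT (f i)) -> (forall i w, 0 <= f i w) ->
  (forall i, Q i -> \int[P]_w (f i w)%:E <= c%:E)%E ->
  (\int[P]_w (\sum_(i | Q i) f i w)%:E <= (#|I|%:R * c)%:E)%E.
Proof.
move=> c0 mf f0 fc.
under eq_integral do rewrite -big_filter -sumEFin.
rewrite ge0_integral_sum//; last 2 first.
- by move=> i; apply/measurable_EFinP.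
- by move=> i w _; rewrite lee_fin.
apply: (@le_trans _ _ (\sum_(i <- seq.filter Q (index_enum I)) c%:E)%E).
  rewrite big_filter [leRHS]big_filter; exact: lee_sum.
rewrite big_filter sumEFin lee_fin [leLHS]big_mkcond/= mulr_natl -sumr_const.
by apply: ler_sum => i _; case: ifP.
Qed.

(** The strict inequality [c < s] yields an admissible value below [s], whether or not the infimum
    is attained. *)
Lemma exp_sqr_le_of_psi2norm (X : T -> R) (c s : R) : measurable_fun setT X ->
  0 <= c -> c < s -> (psi2norm P X <= c%:E)%E ->
  (\int[P]_w (expR ((X w / s) ^+ 2))%:E <= 2%:E)%E.
Proof.
move=> mX c0 cs Xc.
have : (psi2norm P X < s%:E)%E by apply: (le_lt_trans Xc); rewrite lte_fin.
move=> /ereal_inf_lt[_ [y /= [y0 Xy] <-]]; rewrite lte_fin => ys.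
apply: le_trans Xy; apply: le_integral_ge0 => w; first exact: expR_ge0.
have s0 : 0 < s by exact: le_lt_trans cs.
rewrite ler_expR !expr_div_n real_normK ?num_real//.
rewrite ler_wpM2l ?sqr_ge0// lef_pV2 ?posrE ?exprn_gt0//.
by rewrite lerXn2r ?nnegrE ?ltW.
Qed.

Context (p n : nat) (Z : 'I_p -> 'I_n -> T -> R).
Hypothesis indep : mutually_independent P (fun ij : 'I_p * 'I_n => Z ij.1 ij.2).
Hypothesis iZ : forall i j, P.-integrable setT (EFin \o Z i j).
Hypothesis EZ : forall i j, expect P (Z i j) = 0.

Let ZZt w := (\matrix_(i, j) Z i j w) *m (\matrix_(i, j) Z i j w)^T.
Let EZZt := \matrix_(i, k) expect P (fun w => ZZt w i k).

Section Scale.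
Context (s : 'I_p -> R) (m : R).
Hypothesis m0 : 0 < m.
Hypothesis s0 : forall i, 0 < s i.
Hypothesis s_le : forall i, s i <= m.
Hypothesis Zs : forall i j, (\int[P]_w (expR ((Z i j w / s i) ^+ 2))%:E <= 2%:E)%E.

Let mZ i j : measurable_fun setT (Z i j).
Proof. by apply/measurable_EFinP; exact: measurable_int (iZ i j). Qed.

Let V : R := 256 * m ^+ 2.
Let k : R := (48 * V)^-1.

Let V0 : 0 < V. Proof. by apply: mulr_gt0; [rewrite ltr0n|rewrite exprn_gt0]. Qed.

Let combo (th : 'I_p -> R) j w := \sum_i th i * Z i j w.

Let bilin_combo (th et : 'I_p -> R) w : bilin (ZZt w - EZZt) th et =
  \sum_j (combo th j w * combo et j w - expect P (fun w => combo th j w * combo et j w)%R).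
Proof. exact: (bilinear_centered (s := s)). Qed.

Let measurable_bilin (th et : 'I_p -> R) :
  measurable_fun setT (fun w => bilin (ZZt w - EZZt) th et).
Proof.
have mc (a : 'I_p -> R) j : measurable_fun setT (combo a j).
  by apply: measurable_sum => i; apply: measurable_funM.
under eq_fun do rewrite bilin_combo.
by apply: measurable_sum => j; apply: measurable_funB => //; exact: measurable_funM.
Qed.

Lemma integral_specnorm_le_param (N : nat) (u : R) :
  (64 <= N)%N -> \sum_i s i ^+ 2 <= N%:R * m ^+ 2 -> 0 < u -> u <= k / 2 ->
  (\int[P]_w (specnorm (ZZt w - EZZt))%:E <=
   (16 / 7 * (2 / u * (N%:R + 128 * n%:R * (u ^+ 2 / k ^+ 2) + 1)))%:E)%E.
Proof.
move=> N64 sN u0 uk.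
have k0 : 0 < k by rewrite invr_gt0 mulr_gt0.
(* Exactly the exponent in [mgf_bilinear], so that [expR (- L)] cancels the expected partition
   function. *)
pose L : R := n%:R * (256 * (u ^+ 2 / k ^+ 2)).
have L0 : 0 <= L.
  apply: mulr_ge0; first exact: ler0n.
  apply: mulr_ge0; [exact: ler0n|apply: divr_ge0; exact: sqr_ge0].
pose l := u / 2; have l0 : 0 < l by rewrite divr_gt0.
pose W w := partition_fun N s m (ZZt w - EZZt) l.
have W0 w : 0 <= W w.
  rewrite mulr_ge0 ?invr_ge0 ?exprn_ge0//.
  by apply: sumr_ge0 => e _; apply: sumr_ge0 => f _; exact: expR_ge0.
have mexp (th et : 'I_p -> R) :
    measurable_fun setT (fun w => expR (2 * l * bilin (ZZt w - EZZt) th et)).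
  by apply: measurableT_comp => //; apply: measurable_funM.
have mW : measurable_fun setT W.
  apply: measurable_funM => //.
  by apply: measurable_sum_pred => e; exact: measurable_sum_pred.
have IW : (\int[P]_w (W w)%:E <= (expR L)%:E)%E.
  under eq_integral do rewrite EFinM.
  rewrite ge0_integralZl_EFin//; last 2 first.
  - move=> w _; rewrite lee_fin; apply: sumr_ge0 => e _; apply: sumr_ge0 => f _.
    exact: expR_ge0.
  - apply/measurable_EFinP.
    by apply: measurable_sum_pred => e; exact: measurable_sum_pred.
  have J0 : 0 < 4 ^+ #|{: 'I_p * 'I_N}| :> R by rewrite exprn_gt0.
  pose cub : predArgType := {ffun 'I_p * 'I_N -> bool}.
  (* The normalising power of 4 counts all pairs, so an average in which each small pair contributes
     at most [expR L] is itself at most [expR L]. *)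
  have card : #|{: cub}|%:R * #|{: cub}|%:R = 4 ^+ #|{: 'I_p * 'I_N}| :> R.
    by rewrite card_ffun card_bool natrX -exprMn; congr (_ ^+ _); rewrite -natrM.
  apply: (@le_trans _ _ ((4 ^- #|{: 'I_p * 'I_N}|)%:E *
      (#|{: cub}|%:R * (#|{: cub}|%:R * expR L))%:E)%E); last first.
    by rewrite -EFinM lee_fin mulrA card mulKf ?gt_eqF.
  rewrite lee_pmul2l ?lte_fin ?invr_gt0//.
  have sq (e : cub) : small_rounded s m e -> \sum_i rounded e i ^+ 2 * s i ^+ 2 <= V by [].
  apply: integral_sum_le.
  - by rewrite mulr_ge0 ?expR_ge0.
  - by move=> e; exact: measurable_sum_pred.
  - by move=> e w; apply: sumr_ge0 => f _; exact: expR_ge0.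
  move=> e /sq eV; apply: integral_sum_le => //.
  move=> f /sq fV; have -> : 2 * l = u by rewrite /l; field.
  under eq_integral do rewrite bilin_combo.
  apply: (mgf_bilinear indep iZ EZ s0 Zs V0 eV fV).
  by rewrite ger0_norm// ltW.
pose c1 : R := 16 / 7 * (l^-1 * (N%:R + L / 2 + 2^-1)).
pose c2 : R := 16 / 7 * (l^-1 * (2^-1 * expR (- L))).
have c10 : 0 <= c1.
  by rewrite mulr_ge0// mulr_ge0 ?invr_ge0 ?(ltW l0)// !addr_ge0// divr_ge0.
have c20 : 0 <= c2.
  by rewrite mulr_ge0// mulr_ge0 ?invr_ge0 ?(ltW l0)// mulr_ge0 ?expR_ge0.
apply: (@le_trans _ _ (\int[P]_w (c1 + c2 * W w)%:E)%E).
  apply: le_integral_ge0 => w; first exact: specnorm_ge0.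
  have := specnorm_le_partition_fun (ZZt w - EZZt) N64 m0 (fun i => ltW (s0 i)) s_le sN l0 L0.
  by congr (_ <= _); rewrite /c1 /c2 /W; ring.
apply: (le_trans (integral_affine_le mW W0 c10 c20 IW)).
rewrite lee_fin le_eqVlt; apply/orP; left; apply/eqP.
have e1 : expR (- L) * expR L = 1 by rewrite mulrC expRxMexpNx_1.
have -> : c2 * expR L = 16 / 7 * (l^-1 * (2^-1 * (expR (- L) * expR L))) by rewrite /c2; ring.
by rewrite e1 /c1 /l /L; field; rewrite !gt_eqF.
Qed.

Lemma integral_specnorm_le_scale (Y := \sum_i s i ^+ 2 + m ^+ 2) :
  (\int[P]_w (specnorm (ZZt w - EZZt))%:E <=
   (norm_const * (Y + Num.sqrt (n%:R * Y) * m))%:E)%E.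
Proof.
have m2 : 0 < m ^+ 2 by rewrite exprn_gt0.
have S0 : 0 <= \sum_i s i ^+ 2 by apply: sumr_ge0 => i _; exact: sqr_ge0.
have Y0 : 0 <= Y by rewrite addr_ge0// ltW.
pose a : R := (\sum_i s i ^+ 2) / m ^+ 2.
have a0 : 0 <= a by rewrite divr_ge0// ltW.
(* [a] is the effective rank. The successor makes up for truncation and keeps [N] at least 64 even
   for small [a]; the resulting excess is why [Y] contains an extra [m ^+ 2]. *)
pose N := (64 * (Num.truncn a).+1)%N.
have N64 : (64 <= N)%N by rewrite leq_pmulr.
have /andP[ta1 ta2] := truncn_itv a0.
have sN : \sum_i s i ^+ 2 <= N%:R * m ^+ 2.
  rewrite -ler_pdivrMr// -/a /N natrM; lra.
have NY : N%:R * m ^+ 2 <= 64 * Y.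
  have aE : a * m ^+ 2 = \sum_i s i ^+ 2 by rewrite /a divfK// gt_eqF.
  rewrite /Y -aE /N natrM -natr1 -mulrA ler_pM2l// -[X in _ + X]mul1r -mulrDl.
  by rewrite ler_pM2r//; lra.
have N1 : 1 <= N%:R :> R by rewrite ler1n (leq_trans _ N64).
have N0 : 0 < N%:R :> R by exact: lt_le_trans N1.
clearbody N; clear ta1 ta2.
pose r : R := Num.sqrt N%:R; pose q : R := Num.sqrt (N%:R + n%:R); pose t : R := Num.sqrt n%:R.
have r2 : r ^+ 2 = N%:R by rewrite sqr_sqrtr// ltW.
have q2 : q ^+ 2 = N%:R + n%:R by rewrite sqr_sqrtr// addr_ge0// ltW.
have t2 : t ^+ 2 = n%:R by rewrite sqr_sqrtr.
have r0 : 0 < r by rewrite sqrtr_gt0.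
have q0 : 0 < q by rewrite sqrtr_gt0 ltr_wpDr.
have t0 : 0 <= t by exact: sqrtr_ge0.
have rq : r <= q by rewrite ler_wsqrtr// lerDl.
have tq : t <= q by rewrite ler_wsqrtr// lerDr ltW.
have qrt : q <= r + t by rewrite leNgt; apply/negP => h; nra.
have k0 : 0 < k by rewrite invr_gt0 mulr_gt0.
have kE : k^-1 = 48 * 256 * m ^+ 2 by rewrite invrK /V; ring.
(* The terms N / u and n u / k^2 balance at [u] of order k sqrt (N / n); having N + n under the root
   instead keeps [u] at most [k / 2]. *)
pose u := k / 2 * (r / q).
have u0 : 0 < u by rewrite mulr_gt0 ?divr_gt0.
have uk : u <= k / 2 by rewrite ler_piMr ?divr_ge0 ?(ltW k0)// ler_pdivrMr// mul1r.
apply: (le_trans (integral_specnorm_le_param N64 sN u0 uk)).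
rewrite lee_fin /norm_const -[leRHS]mulrA ler_pM2l//.
have ki0 : 0 <= k^-1 by rewrite invr_ge0 ltW.
have b1 : 2 / u * (N%:R + 1) <= 8 * k^-1 * (r ^+ 2 + r * t).
  have -> : 2 / u = 4 * k^-1 * (q / r) by rewrite /u; field; rewrite !gt_eqF.
  apply: (@le_trans _ _ (4 * k^-1 * (q / r) * (2 * r ^+ 2))).
    have qr0 : 0 <= q / r by rewrite divr_ge0// ltW.
    apply: ler_wpM2l; last by rewrite r2; lra.
    by apply: mulr_ge0 => //; exact: mulr_ge0.
  have -> : 4 * k^-1 * (q / r) * (2 * r ^+ 2) = 8 * k^-1 * (r * q).
    by field; rewrite !gt_eqF.
  apply: ler_wpM2l; first exact: mulr_ge0.
  by rewrite expr2 -mulrDr ler_pM2l.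
have b2 : 2 / u * (128 * n%:R * (u ^+ 2 / k ^+ 2)) <= 128 * k^-1 * (r * t).
  have -> : 2 / u * (128 * n%:R * (u ^+ 2 / k ^+ 2)) = 128 * k^-1 * (r * (t * (t / q))).
    by rewrite -t2 /u; field; rewrite !gt_eqF.
  apply: ler_wpM2l; first exact: mulr_ge0.
  by rewrite ler_pM2l// ler_piMr// ler_pdivrMr// mul1r.
have b3 : 2 / u * (N%:R + 128 * n%:R * (u ^+ 2 / k ^+ 2) + 1) <= 136 * k^-1 * (r ^+ 2 + r * t).
  have : 0 <= k^-1 * r ^+ 2 by rewrite mulr_ge0 ?sqr_ge0.
  by lra.
apply: (le_trans b3); rewrite kE.
have c1 : m ^+ 2 * r ^+ 2 <= 64 * Y by rewrite r2 mulrC.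
have c2 : m ^+ 2 * (r * t) <= 64 * (Num.sqrt (n%:R * Y) * m).
  have yt : Num.sqrt (n%:R * Y) = t * Num.sqrt Y by rewrite sqrtrM.
  have y2 : Num.sqrt Y ^+ 2 = Y by rewrite sqr_sqrtr.
  have y0 : 0 <= Num.sqrt Y by exact: sqrtr_ge0.
  have h : m * r <= 8 * Num.sqrt Y.
    have : (m * r) ^+ 2 <= (8 * Num.sqrt Y) ^+ 2 by rewrite !exprMn y2; lra.
    by rewrite ler_pXn2r// nnegrE mulr_ge0// ltW.
  have h' : m * t * (m * r) <= m * t * (8 * Num.sqrt Y).
    by rewrite ler_wpM2l// mulr_ge0// ltW.
  have : 0 <= m * t * Num.sqrt Y by rewrite !mulr_ge0// ltW.
  by rewrite yt; lra.
by lra.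
Qed.

End Scale.

Lemma integral_specnorm_le (CK : R) (sigma : 'I_p -> R)
    (smax := \big[Num.max/0]_i sigma i) (S := \sum_i sigma i ^+ 2) : 0 < CK ->
  (forall i, 0 <= sigma i) ->
  (forall i j, (psi2norm P (Z i j) <= (CK * sigma i)%:E)%E) ->
  (\int[P]_w (specnorm (ZZt w - EZZt))%:E <=
   (norm_const * 8 * CK ^+ 2 * (S + Num.sqrt (n%:R * S) * smax))%:E)%E.
Proof.
move=> CK0 sig0 Zsig.
have smax_ge i : sigma i <= smax by exact: le_bigmax.
have smax0 : 0 <= smax by exact: bigmax_ge_id.
have S0 : 0 <= S by apply: sumr_ge0 => i _; exact: sqr_ge0.
have smaxS : smax ^+ 2 <= S.
  rewrite /smax; elim/big_ind : _ => //.
  - by rewrite expr0n.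
  - by move=> x y hx hy; rewrite /Num.max; case: ifP.
  - by move=> i _; rewrite /S (bigD1 i)//= lerDl sumr_ge0// => j _; exact: sqr_ge0.
have C00 : 0 < norm_const :> R by exact: norm_const_gt0.
have bound (dl : R) : 0 < dl ->
    (\int[P]_w (specnorm (ZZt w - EZZt))%:E <=
     (norm_const * CK ^+ 2 * (4 * S + 2 * dl ^+ 2 +
        Num.sqrt (n%:R * (4 * S + 2 * dl ^+ 2)) * (smax + dl)))%:E)%E.
  move=> dl0.
  (* The shift makes every scale positive and strictly larger than its [psi2norm] bound. The [p]
     rows and the maximum contribute [p.+1] copies of [ep ^+ 2], which add up to [dl ^+ 2]. *)
  pose ep := dl / Num.sqrt p.+1%:R.
  have sp0 : 0 < Num.sqrt p.+1%:R :> R by rewrite sqrtr_gt0.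
  have ep0 : 0 < ep by rewrite divr_gt0.
  have ep2 : p.+1%:R * ep ^+ 2 = dl ^+ 2.
    by rewrite expr_div_n sqr_sqrtr// mulrC divfK// gt_eqF.
  have epdl : ep <= dl.
    rewrite ler_pdivrMr// ler_peMr ?(ltW dl0)//.
    by rewrite -[leLHS]sqrtr1 ler_wsqrtr// ler1n.
  pose s i := CK * (sigma i + ep); pose m := CK * (smax + ep).
  have m0 : 0 < m by rewrite mulr_gt0// ltr_wpDl.
  have s0 i : 0 < s i by rewrite mulr_gt0// ltr_wpDl.
  have sm i : s i <= m by rewrite ler_pM2l// lerD2r.
  have Zs i j : (\int[P]_w (expR ((Z i j w / s i) ^+ 2))%:E <= 2%:E)%E.
    apply: exp_sqr_le_of_psi2norm (Zsig i j).
    - by apply/measurable_EFinP; exact: measurable_int (iZ i j).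
    - by rewrite mulr_ge0// ltW.
    - by rewrite ltr_pM2l// ltrDl.
  apply: (le_trans (integral_specnorm_le_scale m0 s0 sm Zs)).
  rewrite lee_fin -mulrA ler_pM2l//.
  set Y := \sum_i s i ^+ 2 + m ^+ 2; pose X := 4 * S + 2 * dl ^+ 2.
  have sq2 (x : R) : (x + ep) ^+ 2 <= 2 * x ^+ 2 + 2 * ep ^+ 2.
    by have := sqr_ge0 (x - ep); lra.
  have YX : Y <= CK ^+ 2 * X.
    rewrite /Y /s /m; under eq_bigr do rewrite exprMn.
    rewrite -mulr_sumr exprMn -mulrDr ler_pM2l ?exprn_gt0//.
    have h : \sum_i (sigma i + ep) ^+ 2 <= 2 * S + p%:R * (2 * ep ^+ 2).
      have -> : 2 * S + p%:R * (2 * ep ^+ 2) = \sum_i (2 * sigma i ^+ 2 + 2 * ep ^+ 2).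
        by rewrite big_split/= -mulr_sumr sumr_const card_ord -[(2 * ep ^+ 2) *+ p]mulr_natl.
      exact: ler_sum.
    have h2 := sq2 smax.
    by rewrite -natr1 in ep2; rewrite /X; lra.
  have Y0 : 0 <= Y by rewrite addr_ge0 ?sqr_ge0// sumr_ge0// => i _; exact: sqr_ge0.
  have X0 : 0 <= X by rewrite addr_ge0// mulr_ge0// sqr_ge0.
  rewrite -/X [leRHS]mulrDr; apply: lerD => //.
  have -> : CK ^+ 2 * (Num.sqrt (n%:R * X) * (smax + dl)) =
      (CK * Num.sqrt (n%:R * X)) * (CK * (smax + dl)) by ring.
  apply: ler_pM; [exact: sqrtr_ge0|exact: ltW| |].
    have -> : CK * Num.sqrt (n%:R * X) = Num.sqrt (CK ^+ 2 * (n%:R * X)).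
      by rewrite [RHS]sqrtrM ?sqr_ge0// sqrtr_sqr ger0_norm// ltW.
    by rewrite ler_wsqrtr// mulrCA ler_wpM2l.
  by rewrite ler_pM2l// lerD2l.
(* If the maximum is positive, [dl := smax] costs only the factor 8, because [smax ^+ 2 <= S]. If
   all scales vanish, the bound is a constant times [dl ^+ 2], and [dl] is taken arbitrarily
   small. *)
have [m0|m0] := ltP 0 smax.
  apply: (le_trans (bound _ m0)); rewrite lee_fin.
  have -> : norm_const * 8 * CK ^+ 2 * (S + Num.sqrt (n%:R * S) * smax) =
     norm_const * CK ^+ 2 * (8 * S + 8 * Num.sqrt (n%:R * S) * smax) by ring.
  rewrite ler_pM2l ?mulr_gt0 ?exprn_gt0//; apply: lerD; first by lra.
  have h : Num.sqrt (n%:R * (4 * S + 2 * smax ^+ 2)) <= 4 * Num.sqrt (n%:R * S).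
    have -> : 4 * Num.sqrt (n%:R * S) = Num.sqrt (4 ^+ 2 * (n%:R * S)).
      by rewrite [RHS]sqrtrM ?sqr_ge0// sqrtr_sqr ger0_norm.
    rewrite ler_wsqrtr// [leRHS]mulrCA ler_wpM2l//; lra.
  have := ler_wpM2r smax0 h; lra.
have sm0 : smax = 0 by apply/le_anti; rewrite m0 smax0.
have s_eq0 : S = 0.
  by rewrite /S big1// => i _; apply/eqP; rewrite sqrf_eq0 eq_le sig0 -sm0 smax_ge.
rewrite sm0 s_eq0 !(mulr0, addr0).
apply/lee_addgt0Pr => e e0; rewrite add0e.
pose c := norm_const * CK ^+ 2 * (2 + Num.sqrt (n%:R * 2)).
have c0 : 0 < c.
  by rewrite mulr_gt0 ?mulr_gt0 ?exprn_gt0// ltr_wpDr// sqrtr_ge0.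
pose dl := Num.sqrt (e / c).
have dl0 : 0 < dl by rewrite sqrtr_gt0 divr_gt0.
have dl2 : dl ^+ 2 = e / c by rewrite sqr_sqrtr// divr_ge0 ?ltW.
apply: (le_trans (bound _ dl0)); rewrite lee_fin sm0 s_eq0 mulr0 !add0r.
rewrite mulrA sqrtrM; last by rewrite mulr_ge0.
rewrite sqrtr_sqr ger0_norm ?(ltW dl0)//.
rewrite [leLHS](_ : _ = c * dl ^+ 2); last by rewrite /c; ring.
by rewrite dl2 mulrC divfK// gt_eqF.
Qed.

End ExpectedNorm.

Unset Implicit Arguments.

(** The scale assumption is stated in multiplied form, so that [sigma i = 0] is meaningful and
    forces row [i] to vanish almost surely. The maximum starts from 0, which is harmless for
    nonnegative scales and gives a value to the empty family. *)
Theorem theorem3p4 (R : realType) (CK : R) (hCK : 0 < CK) :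
  exists C : R, 0 < C /\
  forall (d : measure_display) (T : measurableType d) (P : probability T R)
    (p1 p2 : nat) (Z : 'I_p1 -> 'I_p2 -> T -> R) (sigma : 'I_p1 -> R),
    mutually_independent P (fun ij : 'I_p1 * 'I_p2 => Z ij.1 ij.2) ->
    (forall i j, P.-integrable setT (EFin \o Z i j)) ->
    (forall i j, expect P (Z i j) = 0) ->
    (forall i, 0 <= sigma i) ->
    (forall i j, (psi2norm P (Z i j) <= (CK * sigma i)%:E)%E) ->
    let ZZt := fun w => (\matrix_(i, j) Z i j w) *m (\matrix_(i, j) Z i j w)^T in
    let EZZt := \matrix_(i, k) expect P (fun w => ZZt w i k) in
    (\int[P]_w (specnorm (ZZt w - EZZt))%:E <=
      (C * (\sum_i sigma i ^+ 2
            + Num.sqrt (p2%:R * \sum_i sigma i ^+ 2) * \big[Num.max/0]_i sigma i))%:E)%E.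
Proof.
exists (norm_const * 8 * CK ^+ 2); split.
  by rewrite mulr_gt0 ?exprn_gt0// mulr_gt0// norm_const_gt0.
by move=> *; exact: integral_specnorm_le.
Qed.
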